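(* Let $M$ be a (possibly infinite) matroid on ground set $E$ with connectivity function $\lambda$, and let $k\geq1$ be an integer. Let $\Phi$ be a $k$-daisy of $(E,\lambda)$ which distinguishes at least two $k$-profiles that have the same truncation to a $(k-1)$-profile. Then the set of $k$-flowers extending $\Phi$ has no infinite (strictly) increasing chain with respect to $\leq$.
   Context: Matroids: a (possibly infinite) matroid on $E$ is given by a set $\mathcal{I}$ of subsets of $E$ (independent sets) such that $\emptyset\in\mathcal{I}$; $\mathcal{I}$ is closed under taking subsets; for every non-maximal $J\in\mathcal{I}$ and maximal $J'\in\mathcal{I}$ there is $x\in J'\setminus J$ with $J\cup\{x\}\in\mathcal{I}$; and whenever $J\subseteq X\subseteq E$ with $J\in\mathcal{I}$, the set $\{J'\in\mathcal{I}:J\subseteq J'\subseteq X\}$ has a maximal element. Bases are maximal independent sets. For $X\subseteq E$ let $M\restriction X$ be the restriction to $X$ and $M.X=M/(E\setminus X)$ the contraction onto $X$. The connectivity of $X$ is $\lambda(X)=|B\setminus B'|\in\mathbb{N}\cup\{\infty\}$, where $B$ is a base of $M\restriction X$ and $B'\subseteq B$ is a base of $M.X$ (the value does not depend on the choices). The function $\lambda$ is symmetric, submodular, and limit-closed (unions of chains of sets of connectivity at most $n\in\mathbb{N}$ have connectivity at most $n$). The value $\lambda(A)$ is also called the order of $A$. Profiles: let $S_l=\{S\subseteq E:\lambda(S)<l\}$. An $l$-profile is a subset $P\subseteq S_l$ such that (i) for every $S\in S_l$, $P$ contains exactly one of $S$ and $E\setminus S$; (ii) if $R,S\in S_l$ with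 $R\subsetneq S\in P$ then $R\in P$; (iii) if $R,S\in P$ then $E\setminus(R\cup S)\notin P$. The truncation of a $k$-profile $P$ to a $(k-1)$-profile is $P\cap S_{k-1}$. A set $S$ distinguishes two $k$-profiles if one of them contains $S$ and the other contains $E\setminus S$. A cyclic order on a set $I$ is a total strict cyclic order; $]x,y[$ is the set of elements strictly between $x$ and $y$ when going from $x$ to $y$. An interval of $I$ is a subset $Y\subseteq I$ such that for all distinct $x,z\in Y$ at least one of $]x,z[$ and $]z,x[$ is contained in $Y$; it is non-trivial if $Y\notin\{\emptyset,I\}$. A $k$-pseudoflower is a partition $(P_i)_{i\in I}$ of $E$ (into non-empty classes, called petals) with a cyclically ordered index set $I$ such that the union of any interval of partition classes has order at most $k-1$; the sets displayed by it are the unions $\bigcup_{i\in I'}P_i$ for non-trivial intervals $I'$ of $I$. It distinguishes two profiles if some set displayed by it distinguishes them. A concatenation of a $k$-pseudoflower $(P_i)_{i\in I}$ is a $k$-pseudoflower $(Q_i)_{i\in I'}$ such that for every $i\in I$ there is $f(i)\in I'$ with $P_i\subseteq Q_{f(i)}$, and such that for all intervals $I''$ of $I'$ the set $f^{-1}(I'')$ is an interval of $I$. If $\Phi$ is a concatenation of $\Psi$ one writes $\Phi\leq\Psi$ and says that $\Psi$ extends $\Phi$; $\leq$ is a pre-order. A $k$-flower is a $k$-pseudoflower with at least four petals in which the union of any non-trivial interval of petals has order exactly $k-1$. A $k$-daisy is a $k$-flower such that every concatenation of it with finitely many petals has the property that the non-trivial unions of petals (unions of a non-empty proper subset of the petals)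 which have order $k-1$ are exactly those where the indices of the petals form an interval of the index set. *)

(* Defs.v *)
From mathcomp Require Import all_boot.
From mathcomp Require Import boolp classical_sets functions cardinality.

Set Implicit Arguments.
Unset Strict Implicit.
Unset Printing Implicit Defensive.

Local Open Scope classical_set_scope.
Local Open Scope card_scope.

(* Elements of [option nat] stand for elements of N \cup {oo}, with [None]
   standing for oo. *)
Definition enat := option nat.

Definition enat_lt (v : enat) (n : nat) : bool :=
  if v is Some m then m < n else false.

Definition enat_le (v : enat) (n : nat) : bool :=
  if v is Some m then m <= n else false.

Definition ecard {T : Type} (A : set T) : enat :=
  xget None [set Some n | n in [set n | A #= `I_n]].

Section Matroid.
Context {E : Type}.
Implicit Types (F : set (set E)) (J X B : set E).

Definition maximal_in F J : Prop :=
  F J /\ forall J', F J' -> J `<=` J' -> J' = J.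

Definition restriction F X : set (set E) := [set J | F J /\ J `<=` X].

Definition dual X F : set (set E) :=
  [set J | J `<=` X /\ exists2 B, maximal_in F B & B `&` J = set0].

End Matroid.

(* The ground set of the matroid is the whole type [E]. *)
Record matroid (E : Type) := Matroid {
  indep : set (set E);
  indep0 : indep set0;
  indepS : forall J J', J `<=` J' -> indep J' -> indep J;
  indep_aug : forall J J', indep J -> ~ maximal_in indep J ->
    maximal_in indep J' -> exists2 x, (J' `\` J) x & indep (J `|` [set x]);
  indep_max : forall J X, indep J -> J `<=` X ->
    exists B, maximal_in [set J' | [/\ indep J', J `<=` J' & J' `<=` X]] B
}.

Section Connectivity.
Context {E : Type} (M : matroid E).
Implicit Types X B : set E.

(* The independent sets of M.X = M/(E \ X), where M/Z is the dual of the
   deletion of Z from the dual of M. *)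
Definition contraction_onto X : set (set E) :=
  dual X (restriction (dual setT (indep M)) X).

Definition connectivity X : enat :=
  xget None [set v | exists B B',
    [/\ maximal_in (restriction (indep M) X) B,
        maximal_in (contraction_onto X) B',
        B' `<=` B & v = ecard (B `\` B')]].

Definition small_sets (l : nat) : set (set E) :=
  [set S | enat_lt (connectivity S) l].

Definition profile (l : nat) (P : set (set E)) : Prop :=
  [/\ P `<=` small_sets l,
      forall S, small_sets l S ->
        (P S /\ ~ P (~` S)) \/ (~ P S /\ P (~` S)),
      forall R S, small_sets l R -> small_sets l S -> R `<` S -> P S -> P R
    & forall R S, P R -> P S -> ~ P (~` (R `|` S))].

Definition truncation (l : nat) (P : set (set E)) : set (set E) :=
  P `&` small_sets l.

End Connectivity.

Definition set_distinguishes {E : Type} (S : set E) (P P' : set (set E)) :=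
  (P S /\ P' (~` S)) \/ (P' S /\ P (~` S)).

(* [cyc_rel x y z]: going from x to z one passes y; asymmetry forces x, y and z
   to be pairwise distinct. *)
Record cyclic_order (I : Type) := CyclicOrder {
  cyc_rel : I -> I -> I -> Prop;
  cyc_rot : forall x y z, cyc_rel x y z -> cyc_rel y z x;
  cyc_asym : forall x y z, cyc_rel x y z -> ~ cyc_rel z y x;
  cyc_trans : forall x y z w, cyc_rel x y z -> cyc_rel x z w -> cyc_rel x y w;
  cyc_total : forall x y z, x <> y -> y <> z -> x <> z ->
    cyc_rel x y z \/ cyc_rel z y x
}.

Section Intervals.
Context {I : Type} (c : cyclic_order I).

Definition between (x y : I) : set I := [set z | cyc_rel c x z y].

Definition is_interval (Y : set I) : Prop :=
  forall x z, Y x -> Y z -> x <> z ->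
    between x z `<=` Y \/ between z x `<=` Y.

End Intervals.

Definition nontrivial {I : Type} (Y : set I) : Prop := Y <> set0 /\ Y <> setT.

(* For k = 0 the bound k.-1 is not meaningful; only k >= 1 is intended. *)
Record pseudoflower (E : Type) (M : matroid E) (k : nat) := Pseudoflower {
  petal_index : Type;
  index_cyc : cyclic_order petal_index;
  petal : petal_index -> set E;
  petal_partition : partition setT petal setT;
  petal_order : forall Y : set petal_index, is_interval index_cyc Y ->
    enat_le (connectivity M (\bigcup_(i in Y) petal i)) k.-1
}.

Section Flowers.
Context {E : Type} {M : matroid E} {k : nat}.
Implicit Types Phi Psi : pseudoflower M k.

Definition interval Phi (Y : set (petal_index Phi)) : Prop :=
  is_interval (index_cyc Phi) Y.

Definition petals_union Phi (Y : set (petal_index Phi)) : set E :=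
  \bigcup_(i in Y) petal i.

Definition displayed Phi : set (set E) :=
  [set petals_union Y | Y in
    [set Y : set (petal_index Phi) | interval Y /\ nontrivial Y]].

Definition distinguishes Phi (P P' : set (set E)) : Prop :=
  exists2 S, displayed Phi S & set_distinguishes S P P'.

(* [concatenation Phi Psi]: Phi is a concatenation of Psi, that is, Phi <= Psi. *)
Definition concatenation Phi Psi : Prop :=
  exists f : petal_index Psi -> petal_index Phi,
    (forall i, petal i `<=` petal (f i)) /\
    (forall Y : set (petal_index Phi), interval Y -> interval (f @^-1` Y)).

Definition strict_concatenation Phi Psi : Prop :=
  concatenation Phi Psi /\ ~ concatenation Psi Phi.

Definition flower Phi : Prop :=
  `I_4 #<= [set: petal_index Phi] /\
  forall Y : set (petal_index Phi), interval Y -> nontrivial Y ->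
    connectivity M (petals_union Y) = Some k.-1.

Definition daisy Phi : Prop :=
  flower Phi /\
  forall Psi, concatenation Psi Phi -> finite_set [set: petal_index Psi] ->
    forall Y : set (petal_index Psi), nontrivial Y ->
      (connectivity M (petals_union Y) = Some k.-1 <-> interval Y).

End Flowers.

(* Main.v *)
Require Import Defs.
From mathcomp Require Import all_boot.
From mathcomp Require Import boolp classical_sets functions cardinality.
From mathcomp Require Import zify.

Set Implicit Arguments.
Unset Strict Implicit.
Unset Printing Implicit Defensive.

Local Open Scope classical_set_scope.
Local Open Scope card_scope.

(** Write [kappa] for [k.-1], and order for connectivity.

    Matroids. The heart is [lam_limit_lt]. Let [V 0 = set0], [V 1], [V 2], ...
    be increasing sets, all differences of which have order [kappa], and suppose
    that the strips [V 1] and [V 3 \ V 2], which are not adjacent, have a union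
    of larger order. Then the union of all [V i] has order less than [kappa].
    This fails for general limit-closed connectivity functions. For matroids, one
    colours the strips alternately with two colours [C] and [D] and writes [Q] for
    the rest of the ground set. By [lam_split], the order of [Q] is its local
    connectivity with [C] in the matroid plus its local connectivity with [D] in
    the dual matroid. Because submodularity is tight for intervals of strips, the
    strips of one colour are skew to [Q] over the first strip of that colour
    ([conn_strip]); as circuits may be infinite, this passes to the limit through
    fundamental circuits. So only the first two strips matter, and comparing the
    two ways of colouring shows that an order of [kappa] in the limit would
    force the order of [V 1] with [V 3 \ V 2] down to [kappa].

    Profiles. A daisy distinguishing two profiles yields a partition of the
    circle into four arcs one of which distinguishes them ([displayed_quad]), and
    opposite arcs have a union of order larger than [kappa] ([daisy_quad]). In an
    infinite strictly increasing chain of flowers every step creates a new cut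
    inside one of the four arcs, so that one arc receives infinitely many cuts
    and these contain a strictly monotone sequence, which has a limit cut. By the
    first part, the arcs that lead from the ends of the four arcs to the limit
    cut have order less than [kappa], hence do not distinguish profiles with the
    same truncation. But the distinguishing arc or its complement is left over
    when two such arcs, on different sides of the limit cut, are removed from the
    circle, and then one of these two has to distinguish the profiles as well
    ([no_arc_limit]).

    Nullity replaces rank throughout: all orders that occur are finite, and so is
    the nullity of a union of bases of finitely many parts of finite order. *)

(** * Propositional set reasoning *)

(** Unit propagation, followed in [prop_solve] by case distinctions: a classical
    tableau for the propositional goals to which set inclusions reduce, much
    faster on large contexts than an intuitionistic decision procedure. *)
Ltac prop_simpl :=
  repeat match goal with
  | H : False |- _ => destruct H
  | H : True |- _ => clear H
  | H : ~ False |- _ => clear H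
  | H : ~ True |- _ => destruct (H I)
  | H : ?P, H' : ~ ?P |- _ => destruct (H' H)
  | H : ?A = ?A |- _ => clear H
  | H : ~ (?A = ?A) |- _ => destruct (H erefl)
  | H : ?A /\ ?B |- _ => destruct H
  | H : ~ (?A \/ ?B) |- _ => apply not_orP in H
  | H : ~ ~ ?A |- _ => apply contrapT in H
  | H : ~ (?A -> ?B) |- _ => apply not_implyP in H
  | HA : ?A, H : ?A \/ _ |- _ => clear H
  | HA : ?A, H : _ \/ ?A |- _ => clear H
  | HA : ~ ?A, H : ?A \/ _ |- _ => destruct H as [H|H]; [destruct (HA H)|]
  | HA : ~ ?A, H : _ \/ ?A |- _ => destruct H as [H|H]; [|destruct (HA H)]
  | HA : ?A, H : ~ (?A /\ ?B) |- _ =>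
      assert (~ B) by (intro; apply H; split; assumption); clear H
  | HA : ?A, H : ~ (?B /\ ?A) |- _ =>
      assert (~ B) by (intro; apply H; split; assumption); clear H
  | HA : ~ ?A, H : ~ (?A /\ ?B) |- _ => clear H
  | HA : ~ ?A, H : ~ (?B /\ ?A) |- _ => clear H
  | HA : ?A, H : ?A -> ?B |- _ => specialize (H HA)
  | HA : ~ ?A, H : ?A -> ?B |- _ => clear H
  | HB : ?B, H : ?A -> ?B |- _ =>
      lazymatch type of A with Prop => clear H end
  | H : ?A -> False |- _ => change (~ A) in H
  | HB : ~ ?B, H : ?A -> ?B |- _ =>
      lazymatch type of A with Prop =>
        assert (~ A) by (intro; apply HB; apply H; assumption); clear H end
  end.

Ltac prop_solve :=
  prop_simpl;
  lazymatch goal with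
  | H : ?A \/ ?B |- _ => destruct H as [H|H]; prop_solve
  | H : ~ (?A /\ ?B) |- _ =>
      let HA := fresh in
      destruct (EM A) as [HA|HA];
      [assert (~ B) by (intro; apply H; split; assumption); clear H|clear H];
      prop_solve
  | H : ?A -> ?B |- _ =>
      lazymatch type of A with Prop =>
        let HA := fresh in
        destruct (EM A) as [HA|HA]; [specialize (H HA)|clear H]; prop_solve
      end
  end.

(** A set-theoretic goal is decided at the single point [x]: every inclusion and
    every equation between sets of the context is instantiated at [x], and
    hypotheses that do not speak of [x] are dropped. *)
Ltac set_at x :=
  repeat match goal with
  | H : @subset _ ?A ?B |- _ => move: (H x) => {}H
  | H : ?A = ?B |- _ =>
    lazymatch type of A with
    | set _ => idtac
    | _ -> Prop => idtac
    end;
    let H1 := fresh in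
    assert (H1 : forall z, A z <-> B z) by (intros ?; rewrite H; split; exact id);
    clear H; destruct (H1 x); clear H1
  end;
  generalize dependent x;
  repeat match goal with H : ?P |- _ => lazymatch type of P with Prop => clear H end end;
  let y := fresh in intro y; intros;
  cbv beta delta [setU setI setD setC set0 setT set1 mkset] in *;
  apply: contrapT;
  let H := fresh in intro H; prop_solve.

Ltac sets :=
  intros;
  lazymatch goal with
  | |- @eq (_ -> Prop) _ _ => apply/seteqP; split
  | |- @eq (set _) _ _ => apply/seteqP; split
  | |- _ => idtac
  end;
  lazymatch goal with
  | |- @subset _ _ _ => let x := fresh "x" in intro x; set_at x
  | |- False => fail
  | |- ~ _ ?x => set_at x
  | |- _ ?x => set_at x
  end.

(** Singletons need the case distinction whether the generic point is one of the
    points of the context. *)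
Ltac set_eq_at x :=
  let T := type of x in
  first [ match goal with
  | y : T |- _ =>
      lazymatch y with x => fail | _ => idtac end;
      lazymatch goal with
      | H : x <> y |- _ => fail
      | _ => case: (EM (x = y)); [move=> ?; subst x; set_at y|move=> ?; set_eq_at x]
      end
  end | set_at x ].

Ltac sets_eq :=
  intros;
  lazymatch goal with
  | |- @eq (_ -> Prop) _ _ => apply/seteqP; split
  | |- @eq (set _) _ _ => apply/seteqP; split
  | |- _ => idtac
  end;
  lazymatch goal with
  | |- @subset _ _ _ => let x := fresh "x" in intro x; set_eq_at x
  | |- ~ _ ?x => set_at x
  | |- _ ?x => set_at x
  end.

(** * Finite cardinals *)

Section Cardinals.
Variable E : Type.
Implicit Types A B C : set E.

Lemma card0P A : A #= `I_0 <-> A = set0.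
Proof. by rewrite II0 card_eq0; split=> /eqP. Qed.

Lemma card_disjU A B m n : A #= `I_m -> B #= `I_n -> A `&` B = set0 ->
  A `|` B #= `I_(m + n).
Proof.
elim: m A => [|m IH] A; first by move/card0P=> -> ? _; rewrite set0U add0n.
move/eq_cardSP=> [x Ax cA] cB AB; apply/eq_cardSP; exists x; first by left.
rewrite (_ : _ `\ x = A `\ x `|` B); first by apply: IH => //; sets.
have : ~ B x by move=> Bx; have : (A `&` B) x by []; rewrite AB.
by sets_eq.
Qed.

Lemma card_inj A m n : A #= `I_m -> A #= `I_n -> m = n.
Proof. by move=> Am An; apply/card_eq_II; apply: card_eq_trans An; apply: card_esym. Qed.

Lemma card_subset A B n : A `<=` B -> B #= `I_n -> exists2 m, m <= n & A #= `I_m.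
Proof.
move=> AB Bn; have /finite_setP[m Am] : finite_set A.
  by apply: sub_finite_set AB _; apply/finite_setP; exists n.
exists m => //; rewrite -card_le_II -(card_le_eql Am) -(card_le_eqr Bn).
exact: subset_card_le.
Qed.

Lemma card_disjU_inv A B n : A `|` B #= `I_n -> A `&` B = set0 ->
  exists a b, [/\ A #= `I_a, B #= `I_b & n = a + b].
Proof.
move=> cU AB.
have [a _ cA] : exists2 m, m <= n & A #= `I_m by apply: card_subset cU; sets.
have [b _ cB] : exists2 m, m <= n & B #= `I_m by apply: card_subset cU; sets.
by exists a, b; split=> //; apply: card_inj cU _; apply: card_disjU.
Qed.
End Cardinals.

(** * Bases of sets in an infinite matroid *)

Section Base.
Variables (E : Type) (M : matroid E).
Implicit Types A B C I J X Y Z : set E.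

Definition base X B := maximal_in (restriction (indep M) X) B.

Lemma base_indep X B : base X B -> indep M B.
Proof. by case=> -[]. Qed.

Lemma base_sub X B : base X B -> B `<=` X.
Proof. by case=> -[]. Qed.

Lemma base_max X B x : base X B -> X x -> indep M (B `|` [set x]) -> B x.
Proof.
move=> [[_ BX] mB] Xx iBx; rewrite -(mB (B `|` [set x])); first by right.
- by split=> //; move=> y [/BX//|->].
- by left.
Qed.

Lemma baseI X B : indep M B -> B `<=` X ->
  (forall x, X x -> indep M (B `|` [set x]) -> B x) -> base X B.
Proof.
move=> iB BX mB; split=> // J [iJ JX] BJ; apply/seteqP; split=> // x Jx.
apply: mB; first exact: JX.
by apply: indepS iJ => y [/BJ//|->].
Qed.

Lemma base_ex I X : indep M I -> I `<=` X -> exists2 B, base X B & I `<=` B.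
Proof.
move=> iI IX; have [B [[iB IB BX] mB]] := indep_max iI IX.
exists B => //; split=> // J [iJ JX] BJ; apply: mB => //; split=> //.
exact: subset_trans BJ.
Qed.

Lemma base_exists X : exists B, base X B.
Proof. by have [B ? _] := base_ex (indep0 M) (@sub0set _ X); exists B. Qed.

Lemma base_maxT B : maximal_in (indep M) B <-> base setT B.
Proof.
split=> [[iB mB]|[[iB _] mB]]; first by split=> // J [iJ _]; apply: mB.
by split=> // J iJ; apply: mB.
Qed.

Lemma base_setT_sub X B C : base X B -> C `<=` X -> base setT C -> base setT B.
Proof.
move=> bB CX bC; apply: contrapT => nB.
have [x [Cx nBx] iBx] : exists2 x, (C `\` B) x & indep M (B `|` [set x]).
  apply: indep_aug; [exact: base_indep bB | by rewrite base_maxT | exact/base_maxT].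
by apply: nBx; apply: base_max bB _ iBx; apply: CX.
Qed.

(** Augmentation holds inside every set [X], not just for bases of the whole
    matroid. If it failed for [I] and [C], extend [C] to a base of the matroid and
    [I] inside it to a base [J]; exchanging a further element [y] of [X] into [J]
    drops some [z] outside [X], and the augmentation axiom for
    [C] together with what is left outside [X] adds an element of [X] to [C]. *)
Lemma base_aug X I C : indep M I -> I `<=` X -> ~ base X I -> base X C ->
  exists x, [/\ C x, ~ I x & indep M (I `|` [set x])].
Proof.
move=> iI IX nI bC; apply: contrapT => noaug.
have {}noaug x : C x -> indep M (I `|` [set x]) -> I x.
  by move=> Cx iIx; apply: contrapT => nIx; apply: noaug; exists x.
have [B bB CB] := base_ex (base_indep bC) (@subsetT _ C).
have BX x : B x -> X x -> C x.
  move=> Bx Xx; apply: base_max bC Xx _.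
  by apply: indepS (base_indep bB) => y [/CB//|->].
have [J bJ IJ] := base_ex iI (@subsetUl _ I B).
have bJT : base setT J by apply: base_setT_sub bJ _ bB; sets.
have JX x : J x -> X x -> I x.
  move=> Jx Xx; case: (base_sub bJ Jx) => // Bx.
  apply: noaug; first exact: BX.
  by apply: indepS (base_indep bJ) => y [/IJ//|->].
have [y [Xy iIy nIy]] : exists y, [/\ X y, indep M (I `|` [set y]) & ~ I y].
  apply: contrapT => h; apply: nI; apply: baseI => // x Xx iIx.
  by apply: contrapT => nIx; apply: h; exists x.
have [J2 bJ2 IJ2] := @base_ex (I `|` [set y]) (J `|` [set y]) iIy ltac:(sets).
have bJ2T : base setT J2 by apply: base_setT_sub bJ2 _ bJT; sets.
have [z [Jz nJ2z]] : exists z, J z /\ ~ J2 z.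
  apply: contrapT => h; apply: nIy; apply: JX => //.
  apply: (base_max bJT) => //; apply: indepS (base_indep bJ2) => x [Jx|->].
    by apply: contrapT => ?; apply: h; exists x.
  by apply: IJ2; right.
have nIz : ~ I z by move=> Iz; apply: nJ2z; apply: IJ2; left.
have nXz : ~ X z by move=> Xz; apply: nIz; apply: JX.
have Bz : B z by case: (base_sub bJ Jz).
have KB : C `|` (J2 `\` X) `<=` B.
  move=> x [/CB//|[J2x nXx]]; case: (base_sub bJ2 J2x) => [Jx|xy].
    by case: (base_sub bJ Jx) => // /IX.
  by case: nXx; rewrite xy.
have iK := indepS KB (base_indep bB).
have [x [J2x nKx] iKx] :
    exists2 x, (J2 `\` (C `|` (J2 `\` X))) x & indep M ((C `|` (J2 `\` X)) `|` [set x]).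
  apply: indep_aug => //; last exact/base_maxT.
  move=> [_ /(_ _ (base_indep bB) KB) BK].
  have : (C `|` (J2 `\` X)) z by rewrite -BK.
  by move=> [/(base_sub bC)//|[]].
have Xx : X x by apply: contrapT => ?; apply: nKx; right.
apply: nKx; left; apply: base_max bC Xx _.
by apply: indepS iKx; sets.
Qed.

Lemma base_of_sub X Y B C : base X C -> C `<=` Y -> Y `<=` X -> base Y B -> base X B.
Proof.
move=> bC CY YX bB; apply: contrapT => nB.
have [|x [Cx nBx iBx]] := base_aug (base_indep bB) _ nB bC.
  by apply: subset_trans YX; apply: base_sub bB.
by apply: nBx; apply: base_max bB _ iBx; apply: CY.
Qed.

Lemma base_restr X Y B : base X B -> B `<=` Y -> Y `<=` X -> base Y B.
Proof.
move=> bB BY YX; apply: baseI => //; first exact: base_indep bB.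
by move=> x /YX; apply: base_max.
Qed.

Lemma base_swap X B x y : base X B -> B x -> X y ->
  indep M (B `\ x `|` [set y]) -> ~ B y -> base X (B `\ x `|` [set y]).
Proof.
move=> bB Bx Xy iy nBy; apply: contrapT => nb.
have [|z [Bz nz iz]] := base_aug iy _ nb bB.
  by move: (base_sub bB); sets_eq.
have zx : z = x by apply: contrapT => zx; apply: nz; left.
apply: nBy; apply: base_max bB Xy _; apply: indepS iz; rewrite zx.
by sets_eq.
Qed.

(** Exchanging one element at a time, which ends as the difference is finite. *)
Lemma base_card X B C n : base X B -> base X C -> B `\` C #= `I_n ->
  C `\` B #= `I_n.
Proof.
elim: n B => [|n IH] B bB bC.
  move/card0P => BC; apply/card0P; rewrite (proj2 bB C (proj1 bC)) ?setDv//.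
  by sets.
move/eq_cardSP => [x [Bx nCx] c].
have [||||y [Cy nBy iy]] := @base_aug X (B `\ x) C.
- by apply: indepS (base_indep bB); sets.
- by move: (base_sub bB); sets.
- move=> [_ /(_ B (proj1 bB)) h].
  have : (B `\ x) x by rewrite -h //; sets.
  by move=> [_]; apply.
- exact: bC.
have {}nBy : ~ B y by move=> By; apply: nBy; split=> // yx; apply: nCx; rewrite -yx.
have bB' := base_swap bB Bx (base_sub bC Cy) iy nBy.
apply/eq_cardSP; exists y => //.
rewrite (_ : _ `\ y = C `\` (B `\ x `|` [set y])); last by sets_eq.
by apply: IH => //; rewrite (_ : _ `\` C = (B `\` C) `\ x) //; sets_eq.
Qed.

(** This makes nullity independent of the base. *)
Lemma base_cardD X B C n : base X B -> base X C -> X `\` B #= `I_n ->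
  X `\` C #= `I_n.
Proof.
move=> bB bC; have BX := base_sub bB; have CX := base_sub bC.
rewrite {1}(_ : X `\` B = (C `\` B) `|` (X `\` (B `|` C))); last by sets.
move/card_disjU_inv => -[|a [b [ca cb ->]]]; first by sets.
rewrite (_ : X `\` C = (B `\` C) `|` (X `\` (B `|` C))); last by sets.
by apply: card_disjU => //; [exact: base_card bC bB ca|sets].
Qed.

Lemma indep_sub_base X I B : base X B -> indep M I -> B `<=` I -> I `<=` X -> I = B.
Proof. by move=> [_ mB] iI BI IX; apply: mB. Qed.
End Base.

Section Circuit.
Variables (E : Type) (M : matroid E).
Implicit Types A B C I J X Y Z : set E.

(** The displayed set is the fundamental circuit of [e]. Were it independent, it
    would extend to a base of [B] with [e] added, which misses exactly one element
    [f] as [B] does; but then [f] belongs to the fundamental circuit. *)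
Lemma fundamental_circuit B e : indep M B -> ~ indep M (B `|` [set e]) ->
  ~ indep M ([set f | B f /\ indep M (B `\ f `|` [set e])] `|` [set e]).
Proof.
move=> iB nBe; set K := (X in indep M X); move=> iK.
have KBe : K `<=` B `|` [set e] by move=> x [[]|]; [left|right].
have [C bC KC] := base_ex iK KBe.
have nBe' : ~ B e.
  by move=> Be; apply: nBe; rewrite (_ : _ `|` _ = B) //; sets_eq.
have bB : base M (B `|` [set e]) B.
  by apply: baseI; [|sets|move=> x [//|->] /nBe].
have : (B `|` [set e]) `\` C #= `I_1.
  apply: base_cardD bB bC _; apply/eq_cardSP; exists e; first by sets.
  by apply/card0P; sets_eq.
move=> /eq_cardSP[f [Bef nCf]] /card0P CE.
have Ce : C e by apply: KC; right.
have Bf : B f by case: Bef => // fe; move: nCf; rewrite fe.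
apply: nCf; apply: KC; left; split=> //.
apply: indepS (base_indep bC) => x; case: (EM (C x)) => // nCx [[Bx xf]|->//].
have : (((B `|` [set e]) `\` C) `\ f) x by split=> //; split=> //; left.
by rewrite CE.
Qed.
End Circuit.

(** * The dual matroid *)

Section Dual.
Variables (E : Type) (M : matroid E).
Implicit Types A B C I J X Y Z N : set E.

Definition coindep := dual setT (indep M).

Lemma coindepP J : coindep J <-> exists2 B, base M setT B & B `&` J = set0.
Proof.
split=> [[_ [B /base_maxT bB BJ]]|[B bB BJ]]; first by exists B.
by split=> //; exists B => //; apply/base_maxT.
Qed.

Lemma coindep0 : coindep set0.
Proof.
have [B bB] := base_exists M setT.
by apply/coindepP; exists B => //; rewrite setI0.
Qed.

Lemma coindepS J J' : J `<=` J' -> coindep J' -> coindep J.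
Proof. by move=> JJ' /coindepP[B bB BJ]; apply/coindepP; exists B => //; sets. Qed.

(** A base of the matroid that is as large as possible on [Y] is as small as
    possible outside [Y], so that its complement is as large as possible there. *)
Lemma cobase_raw Y B : base M setT B -> base M Y (B `&` Y) ->
  maximal_in (restriction coindep (~` Y)) (~` Y `\` B).
Proof.
move=> bB bBY; split.
  by split; [apply/coindepP; exists B => //; sets|sets].
move=> J [/coindepP[C bC CJ] JY] NJ; apply/seteqP; split=> // x Jx; split; first exact: JY.
move=> Bx.
have nYx : ~ Y x by apply: JY.
have nCx : ~ C x by move=> Cx; have : (C `&` J) x by []; rewrite CJ.
have [|||z [Cz nz iz]] := @base_aug _ M setT (B `\ x) C _ _ _ bC.
- by apply: indepS (base_indep bB); sets.
- by [].
- move=> [_ /(_ B (proj1 bB)) h].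
  have : (B `\ x) x by rewrite -h //; sets.
  by move=> [_]; apply.
have nBz : ~ B z by move=> Bz; apply: nz; split=> // zx; apply: nCx; rewrite -zx.
apply: nBz.
have Yz : Y z.
  apply: contrapT => nYz; have : (C `&` J) z; last by rewrite CJ.
  split=> //; apply: NJ; split=> // Bz; apply: nz; split=> // zx.
  by apply: nCx; rewrite -zx.
suff : (B `&` Y) z by case.
apply: base_max bBY Yz _; apply: indepS iz => w [[Bw Yw]|->]; last by right.
by left; split=> // wx; apply: nYx; rewrite -wx.
Qed.

(** A base avoiding [J] is chosen to contain as much as possible of the base
    complementary to [J']. If it contained all of [J' \ J], it would be the whole
    complement of [J], and [J] would be maximal. *)
Lemma coindep_aug J J' : coindep J -> ~ maximal_in coindep J ->
  maximal_in coindep J' -> exists2 x, (J' `\` J) x & coindep (J `|` [set x]).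
Proof.
move=> /coindepP[B0 bB0 B0J] nJ [/coindepP[B' bB' B'J'] mJ'].
have J'E : ~` B' = J' by apply: mJ'; [apply/coindepP; exists B' => //; sets|sets].
have iB'J : indep M (B' `\` J) by apply: indepS (base_indep bB'); sets.
have [B bB B'B] := @base_ex _ M _ (~` J) iB'J ltac:(sets).
have bBT : base M setT B by apply: base_setT_sub bB _ bB0; sets.
apply: contrapT => h; apply: nJ; split; first by apply/coindepP; exists B0.
have BE : ~` J `<=` B.
  move=> y nJy; case: (EM (B' y)) => B'y; first by apply: B'B.
  apply: contrapT => nBy; apply: h; exists y; first by rewrite -J'E.
  apply/coindepP; exists B => //; move: (base_sub bB) => BJ.
  by sets_eq.
move=> J2 /coindepP[B2 bB2 B2J2] JJ2.
have -> : J2 = ~` B2.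
  apply/seteqP; split; first by sets.
  rewrite -(proj2 bB2 B (proj1 bBT)).
  - by move: (base_sub bB); sets.
  - by sets.
apply/seteqP; split; last by sets.
rewrite -(proj2 bB2 B (proj1 bBT)); sets.
Qed.

Lemma coindep_max J X : coindep J -> J `<=` X ->
  exists B, maximal_in [set J' | [/\ coindep J', J `<=` J' & J' `<=` X]] B.
Proof.
move=> /coindepP[B0 bB0 B0J] JX.
have [I bI] := base_exists M (~` X).
have [B bB IB] := @base_ex _ M _ (~` J) (base_indep bI) ltac:(move: (base_sub bI); sets).
have bBT : base M setT B by apply: base_setT_sub bB _ bB0; sets.
have BX : B `&` ~` X = I.
  apply: (indep_sub_base bI); [|by move: (base_sub bI); sets|by sets].
  by apply: indepS (base_indep bB); sets.
have := @cobase_raw (~` X) B bBT; rewrite BX setCK => /(_ bI)[[ci _] mB].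
exists (X `\` B); split.
  by split=> //; move: (base_sub bB); sets.
by move=> J' [cJ' JJ' J'X]; apply: mB.
Qed.

Definition dual_matroid : matroid E :=
  Matroid coindep0 coindepS coindep_aug coindep_max.
End Dual.

Section DualBase.
Variables (E : Type) (M : matroid E).
Implicit Types A B C I J X Y Z N : set E.

Lemma cobase Y B : base M setT B -> base M Y (B `&` Y) ->
  base (dual_matroid M) (~` Y) (~` Y `\` B).
Proof. exact: cobase_raw. Qed.

(** Choosing a base of [M] outside a dual base [N] of [X], around any base of the
    complement of [X]: the part in [X] is forced to be [X \ N]. *)
Lemma cobase_compl X N B : base (dual_matroid M) X N -> base M (~` X) B ->
  base M setT ((X `\` N) `|` B).
Proof.
move=> bN bB.
have /coindepP[B0 bB0 B0N] : coindep M N := base_indep bN.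
have NX := base_sub bN; have BX := base_sub bB.
have [C bC BC] := @base_ex _ M _ (~` N) (base_indep bB) ltac:(sets).
have bCT : base M setT C by apply: base_setT_sub bC _ bB0; sets.
have NE : X `\` C = N.
  apply: (indep_sub_base bN); [|by move: (base_sub bC); sets|by sets].
  by apply/coindepP; exists C => //; sets.
have BE : C `&` ~` X = B.
  apply: (indep_sub_base bB); [|by sets|by sets].
  by apply: indepS (base_indep bC); sets.
by rewrite (_ : _ `|` _ = C) // -NE -BE; sets.
Qed.
End DualBase.

(** * Nullity and local connectivity *)

Section Nullity.
Variables (E : Type) (M : matroid E).
Implicit Types A B C D I J X Y Z : set E.

(** Only finite values matter, so that nullity is a relation with natural numbers.
    In contrast to rank, it is finite on the infinite sets to which it is applied. *)
Definition nullity Z n := exists2 B, base M Z B & Z `\` B #= `I_n.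

Lemma nullity_base Z B n : nullity Z n -> base M Z B -> Z `\` B #= `I_n.
Proof. by move=> [C bC cC] bB; apply: base_cardD bC bB cC. Qed.

Lemma nullity_inj Z m n : nullity Z m -> nullity Z n -> m = n.
Proof. by move=> [B bB cB] nZ; apply: card_inj cB _; apply: nullity_base bB. Qed.

Lemma nullity_sub Z Z' n : Z `<=` Z' -> nullity Z' n ->
  exists2 m, m <= n & nullity Z m.
Proof.
move=> ZZ' nZ'; have [B bB] := base_exists M Z.
have [B' bB' BB'] := base_ex (base_indep bB) (subset_trans (base_sub bB) ZZ').
have BE : B' `&` Z = B.
  apply: (indep_sub_base bB); [|by move: (base_sub bB); sets|by sets].
  by apply: indepS (base_indep bB'); sets.
have [|m mn c] := card_subset _ (nullity_base nZ' bB') (A := Z `\` B).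
  by rewrite -BE; sets.
by exists m => //; exists B.
Qed.

Lemma nullity0 Z : indep M Z -> nullity Z 0.
Proof.
by move=> iZ; exists Z; [apply: baseI => //|apply/card0P; rewrite setDv].
Qed.

Lemma nullity0_indep Z : nullity Z 0 -> indep M Z.
Proof.
move=> [B bB /card0P ZB]; rewrite (_ : Z = B); first exact: base_indep bB.
by move: (base_sub bB); sets.
Qed.

(** A set containing a base of [X] spans [X]. *)
Lemma base_span Z X B D : base M X B -> B `<=` Z -> base M Z D ->
  base M (Z `|` X) D.
Proof.
move=> bB BZ bD; apply: baseI; first exact: base_indep bD.
  by move: (base_sub bD); sets.
move=> x Xx iDx; apply: contrapT => nDx.
have nZx : ~ Z x by move=> Zx; apply: nDx; apply: base_max bD Zx iDx.
case: Xx => // Xx.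
have [C bC BC] := @base_ex _ M _ (Z `|` [set x]) (base_indep bB) ltac:(sets).
have nCx : ~ C x.
  move=> Cx; apply: nZx; apply: BZ; apply: base_max bB Xx _.
  by apply: indepS (base_indep bC) => y [/BC//|->].
have [||y [Cy nDy iDy]] := @base_aug _ M (Z `|` [set x]) D C (base_indep bD) _ _ bC.
- by move: (base_sub bD); sets.
- by move=> bD'; apply: nDx; apply: base_max bD' _ iDx; right.
apply: nDy; apply: base_max bD _ iDy.
by case: (base_sub bC Cy) => // yx; case: nCx; rewrite -yx.
Qed.

(** Nullity is supermodular, with the defect given by the nullity of the union of
    two compatible bases. Both bases restrict to [B] on the intersection, so that
    the elements to be deleted can be counted atom by atom. *)
Lemma nullity_modular X Y B I J a b d i :
  base M (X `&` Y) B -> base M X I -> base M Y J -> B `<=` I -> B `<=` J ->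
  nullity X a -> nullity Y b -> nullity (X `&` Y) i -> nullity (I `|` J) d ->
  exists2 u, nullity (X `|` Y) u & u + i = a + b + d.
Proof.
move=> bB bI bJ BI BJ nX nY nXY nIJ.
have BX := base_sub bB; have IX := base_sub bI; have JY := base_sub bJ.
have IY : I `&` Y = B.
  apply: (indep_sub_base bB); [|by sets|by sets].
  by apply: indepS (base_indep bI); sets.
have JX : J `&` X = B.
  apply: (indep_sub_base bB); [|by sets|by sets].
  by apply: indepS (base_indep bJ); sets.
have [U bU] := base_exists M (I `|` J); have UIJ := base_sub bU.
have bU' : base M (X `|` Y) U.
  rewrite (_ : X `|` Y = (I `|` J) `|` X `|` Y); last by sets.
  by apply: base_span bJ _ _; [sets|apply: base_span bI _ bU; sets].
have cd := nullity_base nIJ bU.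
have ci := nullity_base nXY bB.
have := nullity_base nX bI.
rewrite (_ : X `\` I = ((X `&` Y) `\` B) `|` ((X `\` Y) `\` I)); last by sets.
case/card_disjU_inv => [|i' [a' [ci' ca' ->]]]; first by sets.
have := nullity_base nY bJ.
rewrite (_ : Y `\` J = ((X `&` Y) `\` B) `|` ((Y `\` X) `\` J)); last by sets.
case/card_disjU_inv => [|i'' [b' [ci'' cb' ->]]]; first by sets.
have -> := card_inj ci' ci; have -> := card_inj ci'' ci.
exists (i + a' + b' + d); last by lia.
exists U => //.
rewrite (_ : _ `\` U = ((X `&` Y) `\` B) `|` ((X `\` Y) `\` I) `|`
   ((Y `\` X) `\` J) `|` ((I `|` J) `\` U)); last by sets.
apply: card_disjU cd _; last by sets.
apply: card_disjU cb' _; last by sets.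
by apply: card_disjU => //; sets.
Qed.

(** Independence over [X] depends only on [X] and not on the base chosen for it.
    A base of the union of [B'] and [C] around [B'] that missed [z] in [C] would
    by augmentation add an element to [B] with [C \ z], which is impossible. *)
Lemma base_setU_swap X B B' C : base M X B -> base M X B' -> C `&` X = set0 ->
  indep M (B `|` C) -> indep M (B' `|` C).
Proof.
move=> bB bB' CX iBC.
have [D bD B'D] := @base_ex _ M _ (B' `|` C) (base_indep bB') ltac:(sets).
have DBC := base_sub bD; have B'X := base_sub bB'; have BX := base_sub bB.
have bDX : base M (X `|` C) D.
  apply: baseI; [exact: base_indep bD|by sets|].
  move=> x [Xx|Cx] iDx; last by apply: base_max bD _ iDx; right.
  apply: (B'D x); apply: base_max bB' Xx _.
  by apply: indepS iDx => y [/B'D|]; [left|right].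
suff CD : C `<=` D by apply: indepS (base_indep bD); sets.
move=> z Cz; apply: contrapT => nDz.
have nBz : ~ B z by sets.
have [|||y [Dy ny iy]] := @base_aug _ M (X `|` C) ((B `|` C) `\ z) D _ _ _ bDX.
- by apply: indepS iBC; sets.
- by sets.
- move=> [_ /(_ (B `|` C)) h]; have : ((B `|` C) `\ z) z.
    by rewrite -h; [right|split=> //; sets|sets].
  by move=> [_]; apply.
have yz : y <> z by move=> yz; apply: nDz; rewrite -yz.
have nBCy : ~ (B `|` C) y by move=> ?; apply: ny.
case: (DBC _ Dy) => [B'y|Cy]; last by apply: nBCy; right.
apply: nBCy; left; apply: base_max bB (B'X _ B'y) _.
by apply: indepS iy; move: nBz; sets_eq.
Qed.

Lemma nullity_swap X B B' C n : base M X B -> base M X B' -> C `&` X = set0 ->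
  nullity (B `|` C) n -> nullity (B' `|` C) n.
Proof.
move=> bB bB' CX nBC; have BX := base_sub bB; have B'X := base_sub bB'.
have [D bD BD] := @base_ex _ M _ (B `|` C) (base_indep bB) ltac:(sets).
have DBC := base_sub bD.
have DE : D = B `|` (D `&` C) by sets.
have := nullity_base nBC bD.
rewrite (_ : _ `\` D = C `\` D); last by sets.
move=> c; exists (B' `|` (D `&` C)); last first.
  by rewrite (_ : _ `\` _ = C `\` D) //; sets.
have sw := base_setU_swap bB bB'; have sw' := base_setU_swap bB' bB.
apply: baseI; [|by sets|].
  by apply: sw; [sets|rewrite -DE; exact: base_indep bD].
move=> x [B'x|Cx] ix; first by left.
right; split=> //; apply: base_max bD _ _; first by right.
rewrite DE -setUA; apply: sw'; last by rewrite setUA.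
by move: Cx; sets_eq.
Qed.
End Nullity.

Section LocalConnectivity.
Variables (E : Type) (M : matroid E).
Implicit Types A B C D I J X Y Z : set E.

(** Local connectivity, for disjoint [X] and [Y]. *)
Definition conn X Y n :=
  exists B C, [/\ base M X B, base M Y C & nullity M (B `|` C) n].

(** The order of a set, as the local connectivity with its complement; this agrees
    with the definition through a contraction, see [connectivityP]. *)
Definition lam X n := conn X (~` X) n.

Lemma conn_base X Y B C n : X `&` Y = set0 -> conn X Y n ->
  base M X B -> base M Y C -> nullity M (B `|` C) n.
Proof.
move=> XY [B' [C' [bB' bC' nBC]]] bB bC.
have BX := base_sub bB; have CY := base_sub bC; have CY' := base_sub bC'.
have n1 : nullity M (B `|` C') n by apply: nullity_swap nBC; [eassumption|done|sets].
rewrite setUC; rewrite setUC in n1.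
by apply: nullity_swap n1; [eassumption|done|sets].
Qed.

Lemma conn_inj X Y m n : X `&` Y = set0 -> conn X Y m -> conn X Y n -> m = n.
Proof.
move=> XY [B [C [bB bC nBC]]] c.
exact: nullity_inj nBC (conn_base XY c bB bC).
Qed.

Lemma conn_sym X Y n : conn X Y n -> conn Y X n.
Proof. by move=> [B [C [bB bC c]]]; exists C, B; split=> //; rewrite setUC. Qed.

Lemma lamC X n : lam X n -> lam (~` X) n.
Proof. by rewrite /lam setCK; exact: conn_sym. Qed.

Lemma lam_inj X m n : lam X m -> lam X n -> m = n.
Proof. by apply: conn_inj; rewrite setICr. Qed.

Lemma conn_indep X Y I J n : X `&` Y = set0 -> conn X Y n ->
  indep M I -> I `<=` X -> indep M J -> J `<=` Y ->
  exists2 m, m <= n & nullity M (I `|` J) m.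
Proof.
move=> XY c iI IX iJ JY.
have [B bB IB] := base_ex iI IX; have [C bC JC] := base_ex iJ JY.
by apply: nullity_sub (conn_base XY c bB bC); sets.
Qed.

Lemma conn_sub X Y X' Y' n : X `&` Y = set0 -> conn X Y n ->
  X' `<=` X -> Y' `<=` Y -> exists2 m, m <= n & conn X' Y' m.
Proof.
move=> XY c XX YY; have [B bB] := base_exists M X'; have [C bC] := base_exists M Y'.
have [||m mn nm] := conn_indep XY c (base_indep bB) _ (base_indep bC) _.
- exact: subset_trans (base_sub bB) XX.
- exact: subset_trans (base_sub bC) YY.
by exists m => //; exists B, C.
Qed.

(** [Z1] and [Z2] span [X] and [Y] but need not be independent; their nullities
    add up with the local connectivity. *)
Lemma nullity_conn X Y Z1 Z2 B C a b n : X `&` Y = set0 ->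
  base M X B -> B `<=` Z1 -> Z1 `<=` X -> base M Y C -> C `<=` Z2 -> Z2 `<=` Y ->
  nullity M Z1 a -> nullity M Z2 b -> conn X Y n ->
  nullity M (Z1 `|` Z2) (a + b + n).
Proof.
move=> XY bB BZ Z1X bC CZ Z2Y n1 n2 c.
have bB1 := base_restr bB BZ Z1X; have bC1 := base_restr bC CZ Z2Y.
have Z0 : Z1 `&` Z2 = set0 by sets.
have [] := @nullity_modular _ M Z1 Z2 set0 B C a b n 0 _ bB1 bC1 _ _ n1 n2.
- by rewrite Z0; apply: baseI => //; exact: indep0.
- by sets.
- by sets.
- by rewrite Z0; apply: nullity0; exact: indep0.
- exact: conn_base XY c bB bC.
by move=> u nu; rewrite addn0 => <-.
Qed.

Lemma conn_nullity X Y Z1 Z2 B C z : X `&` Y = set0 ->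
  base M X B -> B `<=` Z1 -> Z1 `<=` X -> base M Y C -> C `<=` Z2 -> Z2 `<=` Y ->
  nullity M (Z1 `|` Z2) z ->
  exists a b n, [/\ nullity M Z1 a, nullity M Z2 b, conn X Y n & z = a + b + n].
Proof.
move=> XY bB BZ Z1X bC CZ Z2Y nz.
have [a _ na] := @nullity_sub _ M Z1 (Z1 `|` Z2) z ltac:(sets) nz.
have [b _ nb] := @nullity_sub _ M Z2 (Z1 `|` Z2) z ltac:(sets) nz.
have [n _ nn] := @nullity_sub _ M (B `|` C) (Z1 `|` Z2) z ltac:(sets) nz.
have c : conn X Y n by exists B, C.
exists a, b, n; split=> //; apply: nullity_inj nz _.
exact: (nullity_conn XY bB BZ Z1X bC CZ Z2Y na nb c).
Qed.
Lemma lam_set0 : lam set0 0.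
Proof.
have [B hB] := base_exists M (~` set0); exists set0, B; split=> //.
  by apply: baseI => //; exact: indep0.
by rewrite set0U; apply: nullity0; exact: base_indep hB.
Qed.
End LocalConnectivity.

(** * Submodularity *)

Section Uncross.
Variables (E : Type) (M : matroid E).
Implicit Types A B C D I J X Y Z : set E.

Lemma nullity_finite Z Z' n : Z `<=` Z' -> nullity M Z' n -> exists m, nullity M Z m.
Proof. by move=> ZZ' /(nullity_sub ZZ')[m _ ?]; exists m. Qed.

(** Submodularity with its defect. Nullity is supermodular, and [nullity_conn]
    writes the order of a union of atoms as the nullity of a set [Z] spanning all
    atoms minus the nullities of its two parts. The defect is at least the nullity
    of the union of bases of [X] and [Y] that agree on the intersection. *)
Lemma lam_uncross_defect X Y B I J x y : lam M X x -> lam M Y y ->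
  base M (X `&` Y) B -> base M X I -> base M Y J -> B `<=` I -> B `<=` J ->
  exists i u d, [/\ lam M (X `&` Y) i, lam M (X `|` Y) u,
    nullity M (I `|` J) d & i + u + d <= x + y].
Proof.
move=> lX lY bB bI bJ BI BJ.
have BX := base_sub bB; have IX := base_sub bI; have JY := base_sub bJ.
have IYB : I `&` Y = B.
  apply: (indep_sub_base bB); [|by sets|by sets].
  by apply: indepS (base_indep bI); sets.
have JXB : J `&` X = B.
  apply: (indep_sub_base bB); [|by sets|by sets].
  by apply: indepS (base_indep bJ); sets.
have [B1 b1 IB1] := @base_ex _ M (I `\` Y) (X `\` Y)
  (indepS (@subDsetl _ _ _) (base_indep bI)) ltac:(sets).
have [B2 b2 JB2] := @base_ex _ M (J `\` X) (Y `\` X)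
  (indepS (@subDsetl _ _ _) (base_indep bJ)) ltac:(sets).
have [B3 b3] := base_exists M (~` (X `|` Y)).
have B1X := base_sub b1; have B2Y := base_sub b2; have B3XY := base_sub b3.
have [n1 _ nX] := conn_indep (setICr Y) lY (base_indep bB) ltac:(sets)
  (base_indep b1) ltac:(sets).
have [n2 _ nXC] := conn_indep (setICr Y) lY (base_indep b2) ltac:(sets)
  (base_indep b3) ltac:(sets).
(* [X] and [Y] cut the ground set into four atoms, with bases [B], [B1], [B2]
   and [B3]; every set involved is a union of atoms, hence is spanned by the
   bases of its atoms, and all nullities below are those of parts of the union
   of the four bases. *)
have [K1 bK1 BK1] := @base_ex _ M B3 (B2 `|` B3) (base_indep b3) ltac:(sets).
have [K2 bK2 BK2] := @base_ex _ M B3 (B1 `|` B3) (base_indep b3) ltac:(sets).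
have K1s := base_sub bK1; have K2s := base_sub bK2.
have bK1' : base M (~` X) K1.
  rewrite (_ : ~` X = (B2 `|` B3) `|` (Y `\` X) `|` ~` (X `|` Y)); last by sets.
  by apply: base_span b3 _ _; [sets|apply: base_span b2 _ bK1; sets].
have bK2' : base M (~` Y) K2.
  rewrite (_ : ~` Y = (B1 `|` B3) `|` (X `\` Y) `|` ~` (X `|` Y)); last by sets.
  by apply: base_span b3 _ _; [sets|apply: base_span b1 _ bK2; sets].
have XX := setICr X.
have nZ : nullity M ((B `|` B1) `|` (B2 `|` B3)) (n1 + n2 + x).
  apply: (nullity_conn XX bI _ _ bK1' _ _ nX nXC lX); sets.
have [a1 [a2 [y' [nY nYC lY' e1]]]] := @conn_nullity _ M Y (~` Y) (B `|` B2)
   (B1 `|` B3) J K2 (n1 + n2 + x) (setICr Y) bJ ltac:(sets) ltac:(sets) bK2' ltac:(sets)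
   ltac:(sets) ltac:(rewrite (_ : _ `|` (B1 `|` B3) = (B `|` B1) `|` (B2 `|` B3)) //; clear; sets).
have {lY'} yy := lam_inj lY' lY; subst y'.
have [U bU] := base_exists M (I `|` J); have UIJ := base_sub bU.
have bU' : base M (X `|` Y) U.
  rewrite (_ : X `|` Y = (I `|` J) `|` X `|` Y); last by sets.
  by apply: base_span bJ _ _; [sets|apply: base_span bI _ bU; sets].
have [V bV] := base_exists M (K1 `|` K2); have VK := base_sub bV.
have bV' : base M (~` (X `&` Y)) V.
  rewrite (_ : ~` (X `&` Y) = (K1 `|` K2) `|` ~` X `|` ~` Y); last by sets.
  by apply: base_span bK2' _ _; [sets|apply: base_span bK1' _ bV; sets].
have [c1 [c2 [i [nB nV li e2]]]] := @conn_nullity _ M (X `&` Y) (~` (X `&` Y)) B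
   (B1 `|` B2 `|` B3) B V (n1 + n2 + x) (setICr _) bB ltac:(sets) ltac:(sets) bV' ltac:(sets)
   ltac:(sets) ltac:(rewrite (_ : B `|` _ = (B `|` B1) `|` (B2 `|` B3)) //; clear; sets).
have [d1 [d2 [u [nU nB3 lu e3]]]] := @conn_nullity _ M (X `|` Y) (~` (X `|` Y))
   (B `|` B1 `|` B2)
   B3 U B3 (n1 + n2 + x) (setICr _) bU' ltac:(sets) ltac:(sets) b3 ltac:(sets)
   ltac:(sets) ltac:(rewrite (_ : _ `|` B3 = (B `|` B1) `|` (B2 `|` B3)) //; clear; sets).
have [d nd] : exists m, nullity M (I `|` J) m by apply: nullity_finite nZ; sets.
have [d' nd'] : exists m, nullity M (K1 `|` K2) m by apply: nullity_finite nZ; sets.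
have e0 := nullity_inj nB (nullity0 (base_indep bB)).
have e0' := nullity_inj nB3 (nullity0 (base_indep b3)).
have X1 : (B `|` B1) `&` (B `|` B2) = B by clear -B1X B2Y; sets.
have X2 : (B2 `|` B3) `&` (B1 `|` B3) = B3 by clear -B1X B2Y; sets.
have bI1 := @base_restr _ M X (B `|` B1) I bI
  ltac:(clear -IX IYB IB1; sets) ltac:(clear -BX B1X; sets).
have bJ1 := @base_restr _ M Y (B `|` B2) J bJ
  ltac:(clear -JY JXB JB2; sets) ltac:(clear -BX B2Y; sets).
have [||u1 nu1 e4] := @nullity_modular _ M (B `|` B1) (B `|` B2) B I J n1 a1 d 0 _ bI1 bJ1
   BI BJ nX nY _ nd.
- by rewrite X1; apply: base_restr bB _ _; clear -BX; sets.
- by rewrite X1 -e0.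
have [||u2 nu2 e5] := @nullity_modular _ M (B2 `|` B3) (B1 `|` B3) B3 K1 K2 n2 a2 d' 0 _ bK1 bK2
   BK1 BK2 nXC nYC _ nd'.
- by rewrite X2; apply: base_restr b3 _ _; clear -B1X B2Y B3XY; sets.
- by rewrite X2 -e0'.
have e6 : u1 = d1 by apply: nullity_inj nu1 _; rewrite (_ : _ `|` _ = B `|` B1 `|` B2) //; clear; sets.
have e7 : u2 = c2 by apply: nullity_inj nu2 _; rewrite (_ : _ `|` _ = B1 `|` B2 `|` B3) //; clear; sets.
exists i, u, d; split=> //; lia.
Qed.

Lemma lam_uncross X Y x y : lam M X x -> lam M Y y ->
  exists i u, [/\ lam M (X `&` Y) i, lam M (X `|` Y) u & i + u <= x + y].
Proof.
move=> lX lY; have [B bB] := base_exists M (X `&` Y).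
have [I bI BI] := @base_ex _ M B X (base_indep bB) ltac:(move: (base_sub bB); sets).
have [J bJ BJ] := @base_ex _ M B Y (base_indep bB) ltac:(move: (base_sub bB); sets).
have [i [u [d [li lu _ le]]]] := lam_uncross_defect lX lY bB bI bJ BI BJ.
by exists i, u; split=> //; lia.
Qed.

(** Equality in submodularity means that [X] and [Y] are skew over their
    intersection: independence over it can be checked in [X] and [Y] separately. *)
Lemma lam_tight X Y x y i u B I J : lam M X x -> lam M Y y ->
  lam M (X `&` Y) i -> lam M (X `|` Y) u -> x + y <= i + u ->
  base M (X `&` Y) B -> I `<=` X -> J `<=` Y ->
  indep M (B `|` I) -> indep M (B `|` J) -> indep M (B `|` I `|` J).
Proof.
move=> lX lY li lu le bB IX JY iI iJ; have BXY := base_sub bB.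
have [I' bI' II'] := @base_ex _ M (B `|` I) X iI ltac:(sets).
have [J' bJ' JJ'] := @base_ex _ M (B `|` J) Y iJ ltac:(sets).
have [i' [u' [d [li' lu' nd le']]]] := lam_uncross_defect lX lY bB bI' bJ' ltac:(sets) ltac:(sets).
have := lam_inj li li'; have := lam_inj lu lu' => ? ?; subst i' u'.
have d0 : d = 0 by lia.
rewrite d0 in nd.
by apply: indepS (nullity0_indep nd); sets.
Qed.
End Uncross.

(** * Order and duality *)

Section Duality.
Variables (E : Type) (M : matroid E).
Implicit Types A B C D I J X Y Z Q : set E.

(** The identity that goes beyond submodularity: the order of [Q] splits into a
    contribution of [C] in the matroid and one of the rest in the dual. A base
    of [M] that is a base of [C] and of the union of [C] and [Q] exhibits both
    contributions on one base of [Q]. As [C] may be infinite, this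
    applies to a colouring of infinitely many parts by two colours. *)
Lemma lam_split C Q n : C `&` Q = set0 -> lam M Q n ->
  exists a b, [/\ conn M C Q a, conn (dual_matroid M) (~` (C `|` Q)) Q b & n = a + b].
Proof.
move=> CQ lQ; set D := ~` _.
have [bC hC] := base_exists M C; have [bQ hQ] := base_exists M Q.
have [bR hR] := base_exists M (~` Q).
have CC := base_sub hC; have QQ := base_sub hQ; have RR := base_sub hR.
have [I hI CI] := @base_ex _ M bC (bC `|` bQ) (base_indep hC) ltac:(sets).
have II := base_sub hI.
have hI' : base M (C `|` Q) I.
  rewrite (_ : C `|` Q = (bC `|` bQ) `|` C `|` Q); last by sets.
  by apply: base_span hQ _ _; [sets|apply: base_span hC _ hI; sets].
have [B hB IB] := @base_ex _ M I setT (base_indep hI) (@subsetT _ _).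
have BI : B `&` (C `|` Q) = I.
  apply: (indep_sub_base hI'); [|by sets|by sets].
  by apply: indepS (base_indep hB); sets.
have BC : B `&` C = bC.
  apply: (indep_sub_base hC); [|by sets|by sets].
  by apply: indepS (base_indep hB); sets.
have h1 : base (dual_matroid M) (D `|` Q) ((D `|` Q) `\` B).
  rewrite (_ : D `|` Q = ~` C); last by rewrite /D; sets.
  by apply: cobase => //; rewrite BC.
have h2 : base (dual_matroid M) D (D `\` B).
  by apply: cobase => //; rewrite BI.
have iQB : indep (dual_matroid M) (Q `\` B).
  by apply: indepS (base_indep h1); sets.
have [nQ hnQ QnQ] := base_ex iQB (@subDsetl _ _ _).
have nQQ := base_sub hnQ.
have h3 := cobase_compl hnQ hR.
have h4 : base M (bQ `|` bR) ((Q `\` nQ) `|` bR).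
  by apply: base_restr h3 _ _; sets.
have := nullity_base (conn_base (setICr Q) lQ hQ hR) h4.
rewrite (_ : _ `\` _ = (bQ `\` I) `|` (nQ `&` B)); last by sets.
case/card_disjU_inv => [|a [b [ca cb ->]]]; first by sets.
exists a, b; split=> //.
  by exists bC, bQ; split=> //; exists I => //; rewrite (_ : _ `\` _ = bQ `\` I) //; sets.
exists (D `\` B), nQ; split=> //; exists ((D `|` Q) `\` B).
  by apply: base_restr h1 _ _; sets.
by rewrite (_ : _ `\` _ = nQ `&` B) //; rewrite /D in h1 *; sets.
Qed.

(** The special case of [lam_split] where [C] is empty. *)
Lemma lam_dual Q n : lam M Q n -> lam (dual_matroid M) Q n.
Proof.
move=> lQ; have [a [b [cE cQ ->]]] := lam_split (set0I Q) lQ.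
have [B hB] := base_exists M Q.
have h0 : base M set0 set0 by apply: baseI => //; exact: indep0.
have := conn_base (set0I Q) cE h0 hB; rewrite set0U.
move=> /nullity_inj/(_ (nullity0 (base_indep hB))) ->.
by rewrite set0U in cQ; rewrite add0n; exact: conn_sym.
Qed.

Lemma ecardP (A : set E) n : ecard A = Some n <-> A #= `I_n.
Proof.
rewrite /ecard; case: xgetP => [v -> [m Am <-]|h]; split.
- by move=> [<-].
- by move=> /(card_inj Am) ->.
- by [].
- by move=> An; case: (h (Some n)); exists n.
Qed.

(** The independent sets of the contraction are the subsets of the sets [X \ N] for
    dual bases [N] of [X]; these sets are themselves incomparable. *)
Lemma contraction_baseP X B : maximal_in (contraction_onto M X) B <->
  exists2 N, base (dual_matroid M) X N & B = X `\` N.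
Proof.
split=> [[[BX [N bN NB]] mB]|[N bN ->]].
  have NX := @base_sub _ (dual_matroid M) _ _ bN.
  exists N => //; rewrite (mB (X `\` N)) //; last by sets.
  by split; [sets|exists N => //; sets].
have NX := base_sub bN.
split; first by split; [sets|exists N => //; sets].
move=> J [JX [N' bN' N'J]] NJ.
have N'X := @base_sub _ (dual_matroid M) _ _ bN'.
have NN' : N = N' by apply: (proj2 bN'); [exact: (proj1 bN)|sets].
by rewrite -NN' in N'J; sets.
Qed.

Lemma connectivityP X n : connectivity M X = Some n <-> lam M X n.
Proof.
pose ok v := exists B B', [/\ maximal_in (restriction (indep M) X) B,
        maximal_in (contraction_onto M X) B', B' `<=` B & v = ecard (B `\` B')].
have okP v m : ok v -> (v = Some m <-> lam M X m).
  move=> [B [B' [hB /contraction_baseP[N hN ->] NB ->]]].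
  have [R hR] := base_exists M (~` X).
  have BX : B `<=` X := base_sub hB.
  have h3 := cobase_compl hN hR; have RX := base_sub hR.
  have h4 : base M (B `|` R) ((X `\` N) `|` R) by apply: base_restr h3 _ _; sets.
  have e : (B `|` R) `\` ((X `\` N) `|` R) = B `\` (X `\` N) by sets.
  rewrite ecardP; split=> [c|l].
    by exists B, R; split=> //; exists ((X `\` N) `|` R) => //; rewrite e.
  by rewrite -e; apply: nullity_base h4; exact: conn_base (setICr X) l hB hR.
have [v okv] : exists v, ok v.
  have [N hN] := base_exists (dual_matroid M) X.
  have [R hR] := base_exists M (~` X).
  have [B hB NB] := @base_ex _ M (X `\` N) X
    (indepS (@subsetUl _ _ R) (base_indep (cobase_compl hN hR))) (@subDsetl _ _ _).
  exists (ecard (B `\` (X `\` N))), B, (X `\` N); split=> //.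
  by apply/contraction_baseP; exists N.
rewrite /connectivity; apply: okP.
by apply: (@xgetPex _ None [set v | ok v]); exists v.
Qed.
End Duality.

Section Sum.
Variables (E : Type) (M : matroid E).
Implicit Types A B C D I J X Y Z Q : set E.

(** Submodularity for disjoint sets: what it loses is the local connectivity in
    the matroid and in its dual. *)
Lemma conn_sum X Y x y : X `&` Y = set0 -> lam M X x -> lam M Y y ->
  exists p q z, [/\ conn M X Y p, conn (dual_matroid M) X Y q,
    lam M (X `|` Y) z & p + q + z = x + y].
Proof.
move=> XY lX lY; pose W := ~` (X `|` Y).
have [_ [z [_ lz _]]] := lam_uncross lX lY.
have [w [q [cw cq e1]]] := @lam_split _ M W Y _ ltac:(rewrite /W; sets) lY.
have WE : ~` (W `|` Y) = X by rewrite /W; sets.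
rewrite WE in cq.
have [|p _ cp] := conn_sub (setICr X) lX (@subset_refl _ X) (_ : Y `<=` ~` X).
  by sets.
exists p, q, z; split=> //.
suff : p + z = w + x by lia.
have [B hB] := base_exists M X; have [C hC] := base_exists M Y.
have [D hD] := base_exists M W.
have BX := base_sub hB; have CY := base_sub hC; have DW := base_sub hD.
have WXY : W `&` (X `|` Y) = set0 by rewrite /W; sets.
have [U hU] := base_exists M (B `|` C); have UB := base_sub hU.
have hU' : base M (X `|` Y) U.
  rewrite (_ : X `|` Y = (B `|` C) `|` X `|` Y); last by sets.
  by apply: base_span hC _ _; [sets|apply: base_span hB _ hU; sets].
have [V hV] := base_exists M (D `|` C); have VB := base_sub hV.
have XC : ~` X = W `|` Y by rewrite /W; sets.
have hV' : base M (~` X) V.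
  rewrite XC (_ : W `|` Y = (D `|` C) `|` W `|` Y); last by sets.
  by apply: base_span hC _ _; [sets|apply: base_span hD _ hV; sets].
have n1 := conn_base XY cp hB hC.
have n2 : nullity M (D `|` C) w by apply: conn_base cw hD hC; sets.
have n3 : nullity M ((B `|` C) `|` D) (p + 0 + z).
  by apply: (nullity_conn (setICr _) hU' _ _ hD _ _ n1 (nullity0 (base_indep hD)) lz); sets.
have n4 : nullity M (B `|` (D `|` C)) (0 + w + x).
  by apply: (nullity_conn (setICr _) hB _ _ hV' _ _ (nullity0 (base_indep hB)) n2 lX); sets.
rewrite (_ : B `|` (D `|` C) = (B `|` C) `|` D) in n4; last by sets.
by have := nullity_inj n3 n4; lia.
Qed.
End Sum.

(** * Limits of increasing sequences *)

Section Limit.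
Variables (E : Type).
Implicit Types A B C D I J X Y Z Q : set E.

Lemma card_dichotomy A n : (exists2 F, F `<=` A & F #= `I_n) \/
  (exists2 m, m < n & A #= `I_m).
Proof.
elim: n => [|n [[F FA cF]|[m mn cA]]].
- by left; exists set0; [exact: sub0set|exact/card0P].
- case: (EM (A `<=` F)) => AF.
    by right; exists n => //; rewrite (_ : A = F) //; sets.
  have [x [Ax nFx]] : exists x, A x /\ ~ F x.
    apply: contrapT => h; apply: AF => x Ax; apply: contrapT => nFx.
    by apply: h; exists x.
  left; exists (F `|` [set x]); first by sets_eq.
  apply/eq_cardSP; exists x; first by right.
  by rewrite (_ : _ `\ x = F) //; sets_eq.
- by right; exists m => //; lia.
Qed.

Lemma increasing_subset (V : nat -> set E) : (forall i, V i `<=` V i.+1) ->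
  forall i j, i <= j -> V i `<=` V j.
Proof.
move=> h i j /subnK <-; elim: (j - i) => [//|d IH].
by rewrite addSn; apply: subset_trans (h _).
Qed.

Lemma card_sub_chain (V : nat -> set E) F n : (forall i, V i `<=` V i.+1) ->
  F #= `I_n -> F `<=` \bigcup_i V i -> exists i, F `<=` V i.
Proof.
move=> inc; elim: n F => [|n IH] F.
  by move/card0P => -> _; exists 0; exact: sub0set.
move/eq_cardSP => [x Fx cF] FV.
have [i Fi] : exists i, F `\ x `<=` V i by apply: IH => //; sets.
have [j _ Vx] := FV _ Fx.
exists (i + j) => y Fy.
case: (EM (y = x)) => [->|yx]; first by apply: increasing_subset Vx => //; lia.
by apply: (increasing_subset inc (i := i)); [lia|apply: Fi].
Qed.

(** Orders do not go up in the limit: if more than [k] elements had to be deleted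
    from the union of a base of the limit and a base of its complement, then [k.+1]
    of these would already lie in some [V i], in the union of an independent set
    in [V i] and one outside [V i]. *)
Lemma lam_limit (M : matroid E) (V : nat -> set E) k : (forall i, V i `<=` V i.+1) ->
  (forall i, exists2 m, m <= k & lam M (V i) m) ->
  exists2 m, m <= k & lam M (\bigcup_i V i) m.
Proof.
move=> inc lV; set U := \bigcup_i V i.
have [B hB] := base_exists M U; have [C hC] := base_exists M (~` U).
have BU := base_sub hB; have CU := base_sub hC.
have [I hI CI] := @base_ex _ M C (B `|` C) (base_indep hC) ltac:(sets).
have IBC := base_sub hI.
case: (card_dichotomy ((B `|` C) `\` I) k.+1) => [[F FBI cF]|[m mk cm]]; last first.
  by exists m; [lia|exists B, C; split=> //; exists I].
have [|i FV] := card_sub_chain inc cF (_ : F `<=` U); first by sets.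
have [m mk lm] := lV i.
have VU : V i `<=` U by move=> x; exists i.
have i1 : indep M ((I `|` F) `&` V i) by apply: indepS (base_indep hB); sets.
have i2 : indep M (I `\` V i) by apply: indepS (base_indep hI); sets.
have [||n nm nn] := conn_indep (setICr (V i)) lm i1 _ i2 _; [sets|sets|].
have h : base M ((I `|` F) `&` V i `|` I `\` V i) I.
  by apply: base_restr hI _ _; sets.
have := nullity_base nn h.
rewrite (_ : _ `\` I = F); last by sets.
by move=> /(card_inj cF); lia.
Qed.
End Limit.

Section Strips.
Variables (E : Type) (V : nat -> set E) (k : nat).
Hypothesis V0 : V 0 = set0.
Hypothesis Vinc : forall i, V i `<=` V i.+1.
Implicit Types M : matroid E.

Let U := \bigcup_i V i.

(** The strips [V i.+1 \ V i] are coloured alternately; [strip 0] and [strip 1] are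
    the two colour classes. *)
Definition strip s := \bigcup_t (V (s + t.*2).+1 `\` V (s + t.*2)).

Lemma level_ex x : U x -> exists i, (V i.+1 `\` V i) x.
Proof.
move=> [i _ Vx]; elim: i Vx => [|i IH] Vx; first by rewrite V0 in Vx.
by case: (EM (V i x)) => [/IH//|nx]; exists i.
Qed.

Lemma level_inj x i j : (V i.+1 `\` V i) x -> (V j.+1 `\` V j) x -> i = j.
Proof.
move=> [Vi1 nVi] [Vj1 nVj]; apply/eqP; rewrite eqn_leq; apply/andP; split.
  by rewrite leqNgt; apply/negP => ji; apply: nVi; apply: increasing_subset Vj1.
by rewrite leqNgt; apply/negP => ij; apply: nVj; apply: increasing_subset Vi1.
Qed.

Lemma strip_disj : strip 0 `&` strip 1 = set0.
Proof.
apply/seteqP; split=> // x [[t _ h1] [t' _ h2]].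
by have := level_inj h1 h2; lia.
Qed.

Lemma strip_cover : strip 0 `|` strip 1 = U.
Proof.
apply/seteqP; split=> x.
  by move=> [[t _ [h _]]|[t _ [h _]]]; eexists; eauto.
move=> /level_ex[i hi]; case: (boolP (odd i)) => oi; [right|left].
  by exists i./2 => //; rewrite add1n (_ : i./2.*2.+1 = i) //; lia.
by exists i./2 => //; rewrite add0n (_ : i./2.*2 = i) //; lia.
Qed.

(** All strips of one colour together are no more connected to the limit
    complement than the first one. Tightness makes the strips between two gaps
    skew, over the first strip, to everything beyond; a fundamental circuit of an
    element of the limit complement can then contain no element of any later
    strip, even though infinitely many strips are present. *)
Lemma conn_strip M s a :
  (forall i j, i < j -> lam M (V j `\` V i) k) -> conn M (strip s) (~` U) a ->
  exists2 a0, a <= a0 & conn M (V s.+1 `\` V s) (~` U) a0.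
Proof.
move=> lV cs; set C := strip s; set Q := ~` U; set C0 := _ `\` _.
have CU : C `<=` U by move=> x [t _ [h _]]; eexists; eauto.
have CQ : C `&` Q = set0 by rewrite /Q; sets.
have C0C : C0 `<=` C by move=> x h; exists 0 => //; rewrite addn0.
have [a0 _ c0] := conn_sub CQ cs C0C (@subset_refl _ Q).
exists a0 => //.
have [b0 hb0] := base_exists M C0; have [bQ hbQ] := base_exists M Q.
have [bC hbC b0C] := base_ex (base_indep hb0) (subset_trans (base_sub hb0) C0C).
have b0s := base_sub hb0; have bQs := base_sub hbQ; have bCs := base_sub hbC.
have C0Q : C0 `&` Q = set0 by sets.
have n0 := conn_base C0Q c0 hb0 hbQ.
have [J hJ b0J] := @base_ex _ M b0 (b0 `|` bQ) (base_indep hb0) ltac:(sets).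
have Js := base_sub hJ; have iJ := base_indep hJ.
suff iCJ : indep M (bC `|` J).
  have [|m le nm] := card_subset _ (nullity_base n0 hJ) (A := (bC `|` bQ) `\` (bC `|` J)).
    by sets.
  have := conn_base CQ cs hbC hbQ.
  move=> /nullity_inj -/(_ m) -> //; exists (bC `|` J) => //.
  apply: baseI => //; first by sets.
  move=> x [bCx _|bQx ix]; first by left.
  right; apply: (base_max hJ); first by right.
  by apply: indepS ix; sets.
apply: contrapT => nCJ.
have [B hB CB] := @base_ex _ M bC (bC `|` J) (base_indep hbC) ltac:(sets).
have Bs := base_sub hB; have iB := base_indep hB.
have [e [Je nBe]] : exists e, J e /\ ~ B e.
  apply: contrapT => h; apply: nCJ; apply: indepS iB => x [/CB//|Jx].
  by apply: contrapT => nBx; apply: h; exists x.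
have nBe' : ~ indep M (B `|` [set e]).
  by move=> h; apply: nBe; apply: base_max hB _ h; right.
have nbCe : ~ bC e by move=> /CB.
have Qe : Q e by apply: bQs; case: (Js _ Je) => // /b0C.
apply: (fundamental_circuit iB nBe'); apply: indepS iJ => f [[Bf iBf]|-> //].
case: (Bs _ Bf) => // bCf; case: (EM (b0 f)) => [/b0J//|nb0f].
exfalso; have [t _ hf] := bCs _ bCf.
have t0 : 0 < t.
  rewrite lt0n; apply/eqP => t0; apply: nb0f.
  rewrite t0 addn0 in hf.
  by apply: (base_max hb0) => //; apply: indepS (base_indep hbC) => x [/b0C|->].
set j := (s + t.*2).+1 in hf *.
have Vs : V s.+1 `<=` V (s + t.*2) by apply: increasing_subset => //; lia.
have lX := lV s j ltac:(lia).
have lY := lamC (lV s.+1 j.+1 ltac:(lia)).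
have Vsj : V s.+1 `<=` V j by apply: increasing_subset => //; lia.
have Vsj1 : V s `<=` V s.+1 by [].
have Vj : V j `<=` V j.+1 by [].
have eI : (V j `\` V s) `&` ~` (V j.+1 `\` V s.+1) = C0 by rewrite /C0; sets.
have eU : (V j `\` V s) `|` ~` (V j.+1 `\` V s.+1) = ~` (V j.+1 `\` V j) by sets.
have lI := lV s s.+1 ltac:(lia); rewrite -/C0 -eI in lI.
have lU := lamC (lV j j.+1 ltac:(lia)); rewrite -eU in lU.
have hb0' := hb0; rewrite -eI in hb0'.
have Cs x : C x -> (V j.+1 `\` V j) x -> False.
  by move=> [t' _ h1] h2; have := level_inj h1 h2; rewrite /j; lia.
have VU : V j.+1 `<=` U by move=> x; exists j.+1.
have CVs x : C x -> ~ V s x.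
  by move=> [t' _ [_ nx]] Vx; apply: nx; apply: increasing_subset Vx => //; lia.
apply: nBe'.
have iI1 : indep M (b0 `|` (B `&` V j `\` V s)) by apply: indepS iB; sets.
have iI2 : indep M (b0 `|` ((B `\` V j) `|` [set e])).
  apply: indepS iBf => x [b0x|[[Bx nVx]|->]]; [left|left|by right].
    by split; [apply: CB; apply: b0C|move=> xf; apply: nb0f; rewrite -xf].
  by split=> // xf; apply: nVx; rewrite xf; case: hf.
have := lam_tight lX lY lI lU (leqnn _) hb0' _ _ iI1 iI2.
move=> h; apply: indepS (h _ _) => [x [Bx|->]||].
- case: (EM (V j x)) => Vx; last by right; left.
  left; right; split=> //.
  case: (Bs _ Bx) => [/bCs/CVs//|Jx].
  case: (Js _ Jx) => [/b0s[]//|/bQs Qx].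
  by exfalso; apply: Qx; exists j.
- by right; right.
- by sets.
- move=> x [[Bx nVx]|->] [Vx _].
    case: (Bs _ Bx) => [bCx|Jx]; first by apply: (Cs x) => //; apply: bCs.
    case: (Js _ Jx) => [/b0s/C0C Cx|/bQs Qx]; first by apply: (Cs x).
    by apply: Qx; apply: VU.
  by apply: Qe; apply: VU.
Qed.

(** The order drops in the limit. Otherwise the complement [Q] of the limit has
    order [k]. Colouring the strips in two ways, [lam_split] and [conn_strip] bound
    [2 * k] by the local connectivities, in the matroid and its dual, of [Q] with
    the first two strips. By [conn_sum], adding the first and adding the second
    strip to [Q] yields two sets with orders of sum at most [2 * k]. The first
    has order at least [k], hence the second has order at most [k], and another
    submodularity argument transfers this bound to [V 1] with [V 3 \ V 2]. *)
Lemma lam_limit_lt M m :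
  (forall i j, i < j -> lam M (V j `\` V i) k) ->
  (forall m, m <= k -> ~ lam M (V 1 `|` (V 3 `\` V 2)) m) ->
  lam M U m -> m < k.
Proof.
move=> lV daisy lU; rewrite ltnNge; apply/negP => km.
have ldV i j : i < j -> lam (dual_matroid M) (V j `\` V i) k.
  by move=> ij; apply: lam_dual; apply: lV.
have lV0 j : 0 < j -> lam M (V j) k.
  by move=> j0; have := lV 0 j j0; rewrite V0 setD0.
have [m' m'k lU'] : exists2 m, m <= k & lam M U m.
  apply: (@lam_limit _ M V k) => // -[|i]; last by exists k => //; apply: lV0.
  by rewrite V0; exists 0 => //; apply: lam_set0.
have mm := lam_inj lU lU'; have {m' m'k mm lU'} mk : m = k by lia.
subst m; set Q := ~` U; have lQ : lam M Q k by apply: lamC.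
have s0U : strip 0 `<=` U by rewrite -strip_cover; sets.
have s1U : strip 1 `<=` U by rewrite -strip_cover; sets.
have sd := strip_disj; have sc := strip_cover.
have [a [b' [ca cb' e1]]] := @lam_split _ M (strip 1) Q _ ltac:(rewrite /Q; sets) lQ.
have [b [a' [cb ca' e2]]] := @lam_split _ M (strip 0) Q _ ltac:(rewrite /Q; sets) lQ.
have E1 : ~` (strip 1 `|` Q) = strip 0 by rewrite /Q; sets.
have E0 : ~` (strip 0 `|` Q) = strip 1 by rewrite /Q; sets.
rewrite E1 in cb'; rewrite E0 in ca'.
have [a0 la ca0] := conn_strip lV ca; have [b0 lb cb0] := conn_strip lV cb.
have [a0' la' ca0'] := conn_strip ldV ca'; have [b0' lb' cb0'] := conn_strip ldV cb'.
have V12 := @Vinc 1; have V23 := @Vinc 2.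
have VU i : V i `<=` U by move=> x; exists i.
have V1U := VU 1; have V2U := VU 2; have V3U := VU 3.
have QE : Q = ~` U by [].
have dQ0 : (V 1 `\` V 0) `&` Q = set0 by sets.
have dQ1 : (V 2 `\` V 1) `&` Q = set0 by sets.
have [p0 [q0 [z0 [cp0 cq0 lz0 s0]]]] := conn_sum dQ0 (lV 0 1 isT) lQ.
have [p1 [q1 [z1 [cp1 cq1 lz1 s1]]]] := conn_sum dQ1 (lV 1 2 isT) lQ.
have f1 := conn_inj dQ0 cp0 cb0; have f2 := conn_inj dQ0 cq0 cb0'.
have f3 := conn_inj dQ1 cp1 ca0; have f4 := conn_inj dQ1 cq1 ca0'.
(* adding the first strip to the complement of [V 2] keeps the order, so by
   submodularity adding it to the smaller set [Q] cannot lower the order *)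
have z0k : k <= z0.
  have [i [u [li lu le]]] := lam_uncross lz0 (lamC (lV0 2 isT)).
  rewrite V0 setD0 in li lu.
  rewrite (_ : _ `&` _ = Q) in li; last by sets.
  rewrite (_ : _ `|` _ = ~` (V 2 `\` V 1)) in lu; last by sets.
  have := lam_inj li lQ; have := lam_inj lu (lamC (lV 1 2 isT)); lia.
have [i [u [li lu le]]] := lam_uncross lz1 (lamC (lV0 3 isT)).
rewrite (_ : _ `&` _ = Q) in li; last by sets.
have {}li := lam_inj li lQ.
apply: (daisy u); first by lia.
by rewrite (_ : _ `|` _ = ~` ((V 2 `\` V 1) `|` Q `|` ~` V 3)); [exact: lamC|sets].
Qed.
End Strips.

(** * Arcs converging to a cut *)

Section LimitArcs.
Variables (E : Type) (M : matroid E) (k : nat).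
Implicit Types R X Y : set E.

Definition lam_le X := exists2 m, m <= k & lam M X m.

Lemma lam_leC X : lam_le X -> lam_le (~` X).
Proof. by move=> [m mk lX]; exists m => //; apply: lamC. Qed.

(** Submodularity in the form in which an arc is moved along the circle: the
    bound survives replacing a part [Z] of [X] by a larger set [Y] of order [k]. *)
Lemma lam_leU X Y Z : lam_le X -> lam M Y k -> lam M Z k -> X `&` Y = Z ->
  lam_le (X `|` Y).
Proof.
move=> [m mk lX] lY lZ XY; have [i [u [li lu le]]] := lam_uncross lX lY.
by rewrite XY in li; have := lam_inj li lZ; exists u => //; lia.
Qed.

Variables (Q1 Q2 Q3 Q4 : set E) (x : nat -> set E).
Hypotheses (Q12 : Q1 `&` Q2 = set0) (Q13 : Q1 `&` Q3 = set0)
  (Q14 : Q1 `&` Q4 = set0) (Q23 : Q2 `&` Q3 = set0) (Q24 : Q2 `&` Q4 = set0)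
  (Q34 : Q3 `&` Q4 = set0) (QT : Q1 `|` Q2 `|` Q3 `|` Q4 = setT).
Hypotheses (xQ : forall i, x i `<=` Q1) (xinc : forall i, x i `<=` x i.+1).
Hypotheses (lQ1 : lam M Q1 k)
  (lxx : forall i j, i < j -> lam M (x j `\` x i) k)
  (lx : forall i, lam M (x i) k)
  (lx4 : forall i, lam M (x i `|` Q4) k)
  (lx34 : forall i, lam M (x i `|` (Q3 `|` Q4)) k).
Hypothesis nQ13 : ~ lam_le (Q1 `|` Q3).

(** A union of two opposite arcs, in a partition of the circle into four, has
    order at most [k] for all such partitions if it does for one: the four cuts can
    be moved one at a time, by [lam_leU]. Here one moves from the arcs [x 0] with
    [R], [x 1 \ x 0], [x 2 \ x 1] and the rest to the arcs [Q1], ..., [Q4]. *)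
Lemma four_arcs_order R : R `&` Q1 = set0 -> (forall i, lam M (x i `|` R) k) ->
  ~ lam_le (x 0 `|` R `|` (x 2 `\` x 1)).
Proof.
move=> RQ lxR h.
have s0 := @xQ 0; have s1 := @xQ 1; have s2 := @xQ 2.
have i0 := @xinc 0; have i1 := @xinc 1.
(* the cut at the far end of [R] *)
have {}h : lam_le (x 0 `|` (x 2 `\` x 1)).
  rewrite (_ : _ `|` _ = ~` ((~` (x 0 `|` R `|` (x 2 `\` x 1))) `|` ~` x 2)); last first.
    by clear -s0 s1 s2 i0 i1 RQ; sets.
  apply: lam_leC; apply: lam_leU (lam_leC h) (lamC (lx 2)) (lamC (lxR 2)) _.
  by clear -s0 s1 s2 i0 i1 RQ; sets.
(* the cut at the end of [x 2] *)
have {}h : lam_le ((x 1 `\` x 0) `|` Q4).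
  rewrite (_ : _ `|` _ = ~` ((x 0 `|` (x 2 `\` x 1)) `|` ~` (x 1 `|` Q4))); last first.
    by clear -s0 s1 s2 i0 i1 Q14; sets.
  apply: lam_leC; apply: lam_leU h (lamC (lx4 1)) (lxx (isT : 1 < 2)) _.
  by clear -s0 s1 s2 i0 i1 Q14; sets.
(* the cut at the end of [x 1], and last the one at the end of [x 0] *)
have {}h : lam_le (x 0 `|` Q3).
  rewrite (_ : _ `|` _ = ~` (((x 1 `\` x 0) `|` Q4) `|` ~` (x 0 `|` (Q3 `|` Q4)))); last first.
    by clear -s0 s1 i0 Q14 Q34 Q13; sets.
  apply: lam_leC; apply: lam_leU h (lamC (lx34 0)) (lxx (isT : 0 < 1)) _.
  by clear -s0 s1 i0 Q14 Q13; sets.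
apply: nQ13; rewrite (_ : _ `|` _ = (x 0 `|` Q3) `|` Q1); last by clear -s0; sets.
by apply: lam_leU h lQ1 (lx 0) _; clear -s0 Q13; sets.
Qed.

(** [lam_limit_lt] for the arcs that start at any of the four cuts and end inside
    [Q1]. *)
Lemma arc_limit R : R `&` Q1 = set0 -> (forall i, lam M (x i `|` R) k) ->
  exists2 m, m < k & lam M (\bigcup_i x i `|` R) m.
Proof.
move=> RQ lxR.
pose V i := if i is j.+1 then x j `|` R else set0.
have Vinc i : V i `<=` V i.+1.
  by case: i => [|i] /=; [exact: sub0set|apply: setSU].
have lV i j : i < j -> lam M (V j `\` V i) k.
  case: i j => [|i] [|j] //=; first by rewrite setD0.
  rewrite ltnS => ij; have := @xQ i; have := @xQ j => s1 s2.
  by rewrite (_ : _ `\` _ = x j `\` x i); [exact: lxx|clear -s1 s2 RQ; sets].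
have UE : \bigcup_i V i = \bigcup_i x i `|` R.
  apply/seteqP; split=> y.
    by move=> [[|i] _ //= [xy|Ry]]; [left; exists i|right].
  by move=> [[i _ xy]|Ry]; [exists i.+1 => //; left|exists 1 => //; right].
have [|m mk lU] := @lam_limit _ M V k Vinc.
  by move=> [|i]; [exists 0 => //; apply: lam_set0|exists k => //=].
exists m; last by rewrite -UE.
apply: (@lam_limit_lt _ V k erefl Vinc M m lV _ lU) => n nk ln.
apply: (four_arcs_order RQ lxR); exists n => //.
rewrite /= in ln; rewrite (_ : _ `|` _ = x 0 `|` R `|` ((x 2 `|` R) `\` (x 1 `|` R))) //.
have := @xQ 2 => s2; clear -RQ s2; sets.
Qed.
End LimitArcs.

(** * Profiles *)

Section Profiles.
Variables (E : Type) (M : matroid E) (k : nat) (P P' : set (set E)).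
Hypotheses (pP : profile M k P) (pP' : profile M k P').
Implicit Types X Y Z : set E.

Lemma small_lam X m : lam M X m -> m < k -> small_sets M k X.
Proof. by move=> /connectivityP; rewrite /small_sets /= => ->. Qed.

Lemma profile_sub S X Y : profile M k S -> small_sets M k X -> X `<=` Y -> S Y -> S X.
Proof.
move=> [sS _ hS _] sX XY SY; case: (EM (Y `<=` X)) => YX.
  by rewrite (_ : X = Y) //; apply/seteqP.
by apply: (hS X Y) => //; exact: sS.
Qed.

Lemma distinguish_setC X : set_distinguishes X P P' -> set_distinguishes (~` X) P P'.
Proof. by rewrite /set_distinguishes setCK => -[[]|[]]; [right|left]. Qed.

(** A set of smaller order would be oriented by the common truncation. *)
Lemma distinguish_lam_ge X m : truncation M k.-1 P = truncation M k.-1 P' ->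
  set_distinguishes X P P' -> lam M X m -> k.-1 <= m.
Proof.
move=> t d lX; rewrite leqNgt; apply/negP => mk.
have sX : small_sets M k.-1 X by move/connectivityP: lX; rewrite /small_sets /= => ->.
have sX' : small_sets M k X by apply: small_lam lX _; lia.
have [_ h _ _] := pP; have [_ h' _ _] := pP'.
case: d => -[PX PX'].
  have : truncation M k.-1 P' X by rewrite -t.
  by move=> [? _]; case: (h' _ sX') => -[].
have : truncation M k.-1 P X by rewrite t.
by move=> [? _]; case: (h _ sX') => -[].
Qed.
End Profiles.

Section Profiles3.
Variables (E : Type) (M : matroid E) (k : nat).
Implicit Types X Y Z : set E.

(** The profile that contains the complement of [Z] contains the smaller sets [Y1]
    and [Y2]. If neither of them distinguished, the other profile would contain
    them too, but then by the third axiom it cannot contain [Z]. *)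
Lemma distinguish_part P P' Z Y1 Y2 : profile M k P -> profile M k P' ->
  small_sets M k Y1 -> small_sets M k Y2 ->
  Y1 `|` Y2 = ~` Z -> set_distinguishes Z P P' ->
  set_distinguishes Y1 P P' \/ set_distinguishes Y2 P P'.
Proof.
move=> pP pP' s1 s2 YZ.
wlog [PZ P'Z] : P P' pP pP' / P Z /\ P' (~` Z).
  move=> h d; have d' := d; case: d => d.
    by apply: h.
  have sym S : set_distinguishes S P' P -> set_distinguishes S P P' by case; [right|left].
  by case: (h P' P pP' pP d (or_introl d)) => /sym; [left|right].
move=> _.
have P'1 : P' Y1 by apply: (profile_sub pP') P'Z => //; sets.
have P'2 : P' Y2 by apply: (profile_sub pP') P'Z => //; sets.
have [_ h _ u] := pP.
case: (h _ s1) => -[PY1 PY1']; last by left; right.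
case: (h _ s2) => -[PY2 PY2']; last by right; right.
by case: (u _ _ PY1 PY2); rewrite YZ setCK.
Qed.
End Profiles3.

Section Contradiction.
Variables (E : Type) (M : matroid E) (k : nat) (P P' : set (set E)).

(** Whichever part distinguishes the profiles, this part or its complement forms a
    partition of the ground set with an arc that ends at the limit cut and an arc
    that starts there. By [distinguish_part] one of these two arcs distinguishes
    the profiles as well, but both have too small an order. *)
Lemma no_arc_limit Q1 Q2 Q3 Q4 (x : nat -> set E) : 0 < k ->
  profile M k P -> profile M k P' -> truncation M k.-1 P = truncation M k.-1 P' ->
  Q1 `&` Q2 = set0 -> Q1 `&` Q3 = set0 -> Q1 `&` Q4 = set0 ->
  Q2 `&` Q3 = set0 -> Q2 `&` Q4 = set0 -> Q3 `&` Q4 = set0 ->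
  Q1 `|` Q2 `|` Q3 `|` Q4 = setT ->
  (forall i, x i `<=` Q1) -> (forall i, x i `<=` x i.+1) ->
  lam M Q1 k.-1 -> (forall i j, i < j -> lam M (x j `\` x i) k.-1) ->
  (forall i, lam M (x i) k.-1) -> (forall i, lam M (x i `|` Q4) k.-1) ->
  (forall i, lam M (x i `|` (Q3 `|` Q4)) k.-1) ->
  (forall i, lam M (x i `|` (Q2 `|` Q3 `|` Q4)) k.-1) ->
  ~ lam_le M k.-1 (Q1 `|` Q3) ->
  [\/ set_distinguishes Q1 P P', set_distinguishes Q2 P P',
      set_distinguishes Q3 P P' | set_distinguishes Q4 P P'] -> False.
Proof.
move=> k0 pP pP' t Q12 Q13 Q14 Q23 Q24 Q34 QT xQ xinc lQ1 lxx lx lx4 lx34 lx234 nQ dQ.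
set W := \bigcup_i x i.
have WQ : W `<=` Q1 by move=> y [i _ /xQ].
have lim R : R `&` Q1 = set0 -> (forall i, lam M (x i `|` R) k.-1) ->
    [/\ small_sets M k (W `|` R), small_sets M k (~` (W `|` R)),
        ~ set_distinguishes (W `|` R) P P' & ~ set_distinguishes (~` (W `|` R)) P P'].
  move=> RQ lR.
  have [m mk lW] := arc_limit Q13 Q14 Q34 xQ xinc lQ1 lxx lx lx4 lx34 nQ RQ lR.
  split.
  - by apply: small_lam lW _; lia.
  - by apply: small_lam (lamC lW) _; lia.
  - by move=> /(distinguish_lam_ge pP pP' t)/(_ lW); lia.
  - by move=> /(distinguish_lam_ge pP pP' t)/(_ (lamC lW)); lia.
have [|s0 s0' d0 d0'] := lim set0 (set0I _); first by move=> i; rewrite setU0.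
have [||s4 s4' d4 d4'] := lim Q4 _ _; [by rewrite setIC|by []|].
have [||s3 s3' d3 d3'] := lim (Q3 `|` Q4) _ _; [clear -Q13 Q14; sets|by []|].
have [||s2 s2' d2 d2'] := lim (Q2 `|` Q3 `|` Q4) _ _; [clear -Q12 Q13 Q14; sets|by []|].
case: dQ => d.
- by case: (distinguish_part pP pP' s0 s2' _ (distinguish_setC d)) => //; clear -WQ Q12 Q13 Q14 QT; sets.
- by case: (distinguish_part pP pP' s3 s2' _ d) => //; clear -WQ Q12 Q23 Q24 QT; sets.
- by case: (distinguish_part pP pP' s4 s3' _ d) => //; clear -WQ Q13 Q23 Q34 QT; sets.
- by case: (distinguish_part pP pP' s0 s4' _ d) => //; clear -WQ Q14 Q24 Q34 QT; sets.
Qed.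
End Contradiction.

(** * Intervals of cyclic orders *)

Section Cyclic.
Variables (I : Type) (c : cyclic_order I).
Implicit Types (o x y z w : I) (X Y A G : set I).

Lemma cyc_neq x y z : cyc_rel c x y z -> [/\ x <> y, y <> z & x <> z].
Proof.
have h u v : ~ cyc_rel c u u v.
  by move=> h; apply: (cyc_asym h); apply: cyc_rot; apply: cyc_rot.
by move=> h1; split=> e; subst; [apply: h h1|apply: h (cyc_rot h1)|
  apply: h (cyc_rot (cyc_rot h1))].
Qed.

Lemma cyc_cut_total o x y : x <> o -> y <> o -> x <> y ->
  cyc_rel c o x y \/ cyc_rel c o y x.
Proof.
move=> xo yo xy; case: (@cyc_total _ c o x y); try by [|move=> ?; subst].
  by left.
by move=> h; right; apply: cyc_rot; exact: cyc_rot.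
Qed.

Lemma cyc_cut_between o x w z : cyc_rel c o x w -> cyc_rel c o w z ->
  cyc_rel c x w z.
Proof.
move=> h1 h2; do 2! apply: cyc_rot.
by apply: cyc_trans (cyc_rot h2) (cyc_rot (cyc_rot h1)).
Qed.

Lemma between_cyc_cut o x w z : cyc_rel c o x z -> cyc_rel c x w z ->
  cyc_rel c o x w /\ cyc_rel c o w z.
Proof.
move=> h1 h2; split.
  by do 2! apply: cyc_rot; apply: cyc_trans h2 (cyc_rot h1).
by apply: cyc_rot; apply: cyc_trans (cyc_rot (cyc_rot h1)) (cyc_rot (cyc_rot h2)).
Qed.

Definition convex_from o Y :=
  forall x w z, Y x -> Y z -> cyc_rel c o x w -> cyc_rel c o w z -> Y w.

(** Cutting the circle at [o] turns [cyc_rel c o] into a linear order, and the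
    intervals avoiding [o] become its convex sets. *)
Lemma interval_convex o Y : ~ Y o -> is_interval c Y -> convex_from o Y.
Proof.
move=> nYo iY x w z Yx Yz h1 h2; have h3 := cyc_cut_between h1 h2.
have [_ _ xz] := cyc_neq h3.
case: (iY x z Yx Yz xz) => [|h]; first exact.
by case: nYo; apply: h; do 2! apply: cyc_rot; apply: cyc_trans h1 h2.
Qed.

Lemma convex_interval o Y : ~ Y o -> convex_from o Y -> is_interval c Y.
Proof.
move=> nYo cY.
have key x z : Y x -> Y z -> cyc_rel c o x z -> between c x z `<=` Y.
  by move=> Yx Yz h w /(between_cyc_cut h)[h1 h2]; apply: cY h1 h2.
move=> x z Yx Yz xz; case: (@cyc_cut_total o x z) => [xo|zo|//|h|h].
- by apply: nYo; rewrite -xo.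
- by apply: nYo; rewrite -zo.
- by left; apply: key.
- by right; apply: key.
Qed.

Lemma interval0 : is_interval c set0.
Proof. by []. Qed.

Lemma intervalC Y : is_interval c Y -> is_interval c (~` Y).
Proof.
move=> iY x z nYx nYz xz; apply: contrapT => h.
have [w [Yw hw]] : exists w, Y w /\ cyc_rel c x w z.
  apply: contrapT => h'; apply: h; left => w hw Yw.
  by apply: h'; exists w.
have [v [Yv hv]] : exists v, Y v /\ cyc_rel c z v x.
  apply: contrapT => h'; apply: h; right => v hv Yv.
  by apply: h'; exists v.
have h1 : cyc_rel c w z v.
  by do 2! apply: cyc_rot; apply: cyc_trans hv (cyc_rot (cyc_rot hw)).
have h2 : cyc_rel c v x w.
  by do 2! apply: cyc_rot; apply: cyc_trans hw (cyc_rot (cyc_rot hv)).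
have [_ _ wv] := cyc_neq h1.
by case: (iY w v Yw Yv wv) => s; [apply: nYz; apply: s|apply: nYx; apply: s].
Qed.

Lemma intervalI o X Y : ~ X o -> ~ Y o -> is_interval c X -> is_interval c Y ->
  is_interval c (X `&` Y).
Proof.
move=> nX nY /(interval_convex nX) cX /(interval_convex nY) cY.
apply: (@convex_interval o); first by case.
move=> x w z [Xx Yx] [Xz Yz] h1 h2.
by split; [apply: cX h1 h2|apply: cY h1 h2].
Qed.

Lemma open_arc_interval x y : is_interval c (between c x y).
Proof.
have nx : ~ between c x y x by move=> /cyc_neq[].
apply: (convex_interval nx) => a w b ha hb h1 h2.
exact: cyc_trans h2 hb.
Qed.

(** Four points on a circle can be separated into two pairs by intervals in only
    two of the three ways: seen from [x], the median of the other three points is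
    not separated, together with [x], from the other two. *)
Lemma four_points x y z w Y1 Y2 Y3 :
  is_interval c Y1 -> is_interval c Y2 -> is_interval c Y3 ->
  [/\ Y1 x, Y1 y, ~ Y1 z & ~ Y1 w] -> [/\ Y2 x, Y2 z, ~ Y2 y & ~ Y2 w] ->
  [/\ Y3 x, Y3 w, ~ Y3 y & ~ Y3 z] -> False.
Proof.
move=> i1 i2 i3 [x1 y1 z1 w1] [x2 z2 y2 w2] [x3 w3 y3 z3].
have key S a b d : is_interval c S -> S x -> S b -> ~ S a -> ~ S d ->
    cyc_rel c x a b -> cyc_rel c x b d -> False.
  move=> iS Sx Sb nSa nSd h1 h2.
  by apply: (@interval_convex x (~` S) _ (intervalC iS) a b d) => //; apply.
have ne u v S : S u -> ~ S v -> u <> v by move=> Su nSv e; apply: nSv; rewrite -e.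
have yx : y <> x by apply: nesym; apply: ne x2 y2.
have zx : z <> x by apply: nesym; apply: ne x1 z1.
have wx : w <> x by apply: nesym; apply: ne x1 w1.
have yz : y <> z by apply: ne y1 z1.
have yw : y <> w by apply: ne y1 w1.
have zw : z <> w by apply: ne z2 w2.
have k1 := key _ _ _ _ i1 x1 y1; have k2 := key _ _ _ _ i2 x2 z2.
have k3 := key _ _ _ _ i3 x3 w3.
by case: (cyc_cut_total yx zx yz) => h1; case: (cyc_cut_total yx wx yw) => h2;
  case: (cyc_cut_total zx wx zw) => h3; eauto.
Qed.

(** The cut is placed right after the smaller one of [a] and [b], seen from [o].
    As [G] is convex and disjoint from [A], it lies on one side of the cut, and
    [X] is this side. *)
Lemma interval_split o A G a b : is_interval c A -> is_interval c G ->
  is_interval c (G `|` A) -> A `&` G = set0 -> ~ (G `|` A) o ->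
  A a -> A b -> a <> b -> exists X, [/\ is_interval c X,
    is_interval c ((G `|` A) `\` X), G `<=` X, X `<=` G `|` A &
    (X a /\ ~ X b) \/ (X b /\ ~ X a)].
Proof.
move=> iA iG iGA AG nGAo.
wlog lab : a b / cyc_rel c o a b.
  move=> h Aa Ab ab.
  have ao : a <> o by move=> ao; apply: nGAo; right; rewrite -ao.
  have bo : b <> o by move=> bo; apply: nGAo; right; rewrite -bo.
  case: (cyc_cut_total ao bo ab) => l; first exact: h.
  have [X [? ? ? ? hX]] := h _ _ l Ab Aa (nesym ab); exists X; split=> //.
  by case: hX; [right|left].
move=> Aa Ab ab; have cGA := interval_convex nGAo iGA.
pose L := [set y | (G `|` A) y /\ ~ cyc_rel c o a y].
pose R := [set y | (G `|` A) y /\ cyc_rel c o a y].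
have lt_trans x y z : cyc_rel c o x y -> cyc_rel c o y z -> cyc_rel c o x z.
  exact: cyc_trans.
have iL : is_interval c L.
  apply: (@convex_interval o); first by case.
  move=> x w z [Lx ax] [Lz az] h1 h2; split; first exact: cGA h1 h2.
  by move=> aw; apply: az; apply: lt_trans h2.
have iR : is_interval c R.
  apply: (@convex_interval o); first by case.
  move=> x w z [Lx ax] [Lz az] h1 h2; split; first exact: cGA h1 h2.
  exact: lt_trans h1.
have La : L a by split; [right|move=> /cyc_neq[]].
have Rb : R b by split; [right|].
have LR : (G `|` A) `\` L = R.
  apply/seteqP; split=> y; last by move=> [Gy ay]; split=> // -[].
  by move=> [Gy nLy]; split=> //; apply: contrapT => ay; apply: nLy.
have RL : (G `|` A) `\` R = L.
  apply/seteqP; split=> y; last by move=> [Gy ay]; split=> // -[].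
  by move=> [Gy nLy]; split=> //; move=> ay; apply: nLy.
have nLb : ~ L b by case.
have nRa : ~ R a by case=> _ /cyc_neq[].
case: (EM (G `<=` L)) => GL.
  by exists L; split=> //; [rewrite LR|move=> y []|left].
exists R; split=> //; [by rewrite RL| |by move=> y []|by right].
move=> g Gg; split; first by left.
have [g' [Gg' nLg']] : exists g', G g' /\ ~ L g'.
  by apply: contrapT => h; apply: GL => y Gy; apply: contrapT => nLy; apply: h; exists y.
have ag' : cyc_rel c o a g' by apply: contrapT => h; apply: nLg'; split=> //; left.
apply: contrapT => nag.
have ao : a <> o by move=> ao; apply: nGAo; right; rewrite -ao.
have go : g <> o by move=> go; apply: nGAo; left; rewrite -go.
have nGa : ~ G a by move=> Ga; have : (A `&` G) a by []; rewrite AG.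
have ga : g <> a by move=> ga; apply: nGa; rewrite -ga.
case: (cyc_cut_total go ao ga) => // lga.
have nGo : ~ G o by move=> Go; apply: nGAo; left.
exact: nGa (interval_convex nGo iG Gg Gg' lga ag').
Qed.
End Cyclic.

(** * Intervals of pseudoflowers *)

Section Ival.
Variables (E : Type) (M : matroid E) (k : nat) (Psi : pseudoflower M k).
Implicit Types (X A G : set E) (Y : set (petal_index Psi)) (e : E).

Lemma petal_ex e : exists i : petal_index Psi, petal i e.
Proof.
have [cov _ _] := petal_partition Psi.
by have : [set: E] e by []; rewrite -cov => -[i _ ?]; exists i.
Qed.

Lemma petal_inj (i j : petal_index Psi) e : petal i e -> petal j e -> i = j.
Proof.
have [_ triv _] := petal_partition Psi => pi pj.
by apply: triv => //; exists e.
Qed.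

Lemma petal_nonempty (i : petal_index Psi) : exists e, petal i e.
Proof. by have [_ _ /(_ i I)] := petal_partition Psi. Qed.

Lemma petals_unionP Y (i : petal_index Psi) e : petal i e -> (petals_union Y e <-> Y i).
Proof.
move=> pi; split=> [[j Yj pj]|Yi]; last by exists i.
by rewrite (petal_inj pi pj).
Qed.

Lemma petals_unionE Y (i : petal_index Psi) e : petal i e -> petals_union Y e = Y i.
Proof. by move=> pi; apply/propext; exact: petals_unionP. Qed.

Lemma petals_union_inj Y Y' : petals_union Y = petals_union Y' -> Y = Y'.
Proof.
move=> h; apply/seteqP; split=> i Yi; have [e pe] := petal_nonempty i.
  by apply/(petals_unionP _ pe); rewrite -h; apply/(petals_unionP _ pe).
by apply/(petals_unionP _ pe); rewrite h; apply/(petals_unionP _ pe).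
Qed.

(** Intervals seen as sets of elements, so that intervals of different
    pseudoflowers can be compared. Here the trivial intervals are included. *)
Definition ival X :=
  exists2 Y : set (petal_index Psi), interval Y & X = petals_union Y.

Lemma petals_unionC Y : petals_union (~` Y) = ~` petals_union Y.
Proof.
by apply/seteqP; split=> e; have [i pe] := petal_ex e; rewrite /= !(petals_unionE _ pe).
Qed.

Lemma petals_unionI Y Y' :
  petals_union (Y `&` Y') = petals_union Y `&` petals_union Y'.
Proof.
by apply/seteqP; split=> e; have [i pe] := petal_ex e; rewrite /= !(petals_unionE _ pe).
Qed.

Lemma petals_unionU Y Y' :
  petals_union (Y `|` Y') = petals_union Y `|` petals_union Y'.
Proof.
by apply/seteqP; split=> e; have [i pe] := petal_ex e; rewrite /= !(petals_unionE _ pe).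
Qed.

Lemma ivalC X : ival X -> ival (~` X).
Proof.
move=> [Y iY ->]; exists (~` Y); last by rewrite petals_unionC.
exact: intervalC.
Qed.

Lemma ival0 : ival set0.
Proof.
exists set0; first exact: interval0.
by apply/seteqP; split=> // e [].
Qed.

Lemma ivalI X A : ival X -> ival A -> (exists e, ~ X e /\ ~ A e) -> ival (X `&` A).
Proof.
move=> [Y iY ->] [Z iZ ->] [e []]; have [i pe] := petal_ex e.
rewrite !(petals_unionE _ pe) => nY nZ.
exists (Y `&` Z); last by rewrite petals_unionI.
exact: intervalI nY nZ iY iZ.
Qed.

Lemma ivalU X A : ival X -> ival A -> (exists e, X e /\ A e) -> ival (X `|` A).
Proof.
move=> iX iA [e [Xe Ae]]; rewrite -[_ `|` _]setCK setCU; apply: ivalC.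
by apply: ivalI; [exact: ivalC|exact: ivalC|exists e; split; apply].
Qed.

Lemma ival_lam_le X : ival X -> lam_le M k.-1 X.
Proof.
move=> [Y iY ->]; have := petal_order iY; rewrite -/(petals_union Y).
case e : (connectivity _ _) => [m|//] /= mk; exists m => //.
exact/connectivityP.
Qed.

Lemma ival_lam X : flower Psi -> ival X -> (exists e, X e) -> (exists e, ~ X e) ->
  lam M X k.-1.
Proof.
move=> [_ fl] [Y iY ->] [e Xe] [e' nXe']; apply/connectivityP; apply: fl => //; split.
  by move=> Y0; move: Xe; rewrite Y0 => -[].
move=> YT; apply: nXe'; have [i pe] := petal_ex e'.
by apply/(petals_unionP _ pe); rewrite YT.
Qed.

Lemma displayed_ival X : displayed Psi X -> [/\ ival X, exists e, X e & exists e, ~ X e].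
Proof.
move=> [Y [iY [Y0 YT]] <-]; split; first by exists Y.
  apply: contrapT => h; apply: Y0; apply/seteqP; split=> // i Yi; apply: h.
  by have [e pe] := petal_nonempty i; exists e, i.
apply: contrapT => h; apply: YT; apply/seteqP; split=> // i _.
have [e pe] := petal_nonempty i; apply/(petals_unionP _ pe).
by apply: contrapT => n; apply: h; exists e.
Qed.

Lemma ival_four_points x y z w X1 X2 X3 : ival X1 -> ival X2 -> ival X3 ->
  [/\ X1 x, X1 y, ~ X1 z & ~ X1 w] -> [/\ X2 x, X2 z, ~ X2 y & ~ X2 w] ->
  [/\ X3 x, X3 w, ~ X3 y & ~ X3 z] -> False.
Proof.
move=> [Y1 i1 ->] [Y2 i2 ->] [Y3 i3 ->].
have [i pi] := petal_ex x; have [j pj] := petal_ex y.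
have [l pl] := petal_ex z; have [m pm] := petal_ex w.
rewrite !(petals_unionE _ pi) !(petals_unionE _ pj).
rewrite !(petals_unionE _ pl) !(petals_unionE _ pm).
exact: (@four_points _ _ i j l m _ _ _ i1 i2 i3).
Qed.

Definition same_petal e e' := exists i : petal_index Psi, petal i e /\ petal i e'.

Lemma ival_same_petal X e e' : ival X -> same_petal e e' -> X e -> X e'.
Proof.
by move=> [Y iY ->] [i [pe pe']] /(petals_unionP _ pe) Yi; apply/(petals_unionP _ pe').
Qed.

Lemma ival_split A G a b : ival A -> ival G -> ival (G `|` A) -> A `&` G = set0 ->
  (exists e, ~ (G `|` A) e) -> A a -> A b -> ~ same_petal a b ->
  exists X, [/\ ival X, ival ((G `|` A) `\` X), G `<=` X, X `<=` G `|` A &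
    (X a /\ ~ X b) \/ (X b /\ ~ X a)].
Proof.
move=> [YA iA ->] [YG iG ->] [YU iU]; rewrite -petals_unionU => /petals_union_inj UE.
rewrite -petals_unionI => AG [e]; have [o pe] := petal_ex e.
have [i pi] := petal_ex a; have [j pj] := petal_ex b.
rewrite (petals_unionE _ pe) (petals_unionE _ pi) (petals_unionE _ pj).
move=> no Ai Aj nab; rewrite UE in no; subst YU.
have ij : i <> j by move=> ij; subst; apply: nab; exists j.
have AG0 : YA `&` YG = set0.
  by apply: petals_union_inj; rewrite AG; apply/seteqP; split=> // ? [? []].
have [X [iX iX' GX XU hX]] := interval_split iA iG iU AG0 no Ai Aj ij.
exists (petals_union X); split.
- by exists X.
- by exists ((YG `|` YA) `\` X); rewrite // setDE petals_unionI petals_unionC -setDE.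
- by move=> u [v Gv pv]; exists v => //; apply: GX.
- by move=> u [v Gv pv]; exists v => //; apply: XU.
- by rewrite !(petals_unionE _ pi) !(petals_unionE _ pj).
Qed.
End Ival.

Section Concat.
Variables (E : Type) (M : matroid E) (k : nat).
Implicit Types (Phi Psi : pseudoflower M k) (X : set E).

Lemma ival_concat Phi Psi X : concatenation Phi Psi -> ival Phi X -> ival Psi X.
Proof.
move=> [f [pf cf]] [Y iY ->]; exists (f @^-1` Y); first exact: cf.
apply/seteqP; split=> e; have [i pe] := petal_ex Psi e; have pfe := pf _ _ pe.
  by rewrite (petals_unionE _ pe) (petals_unionE _ pfe).
by rewrite (petals_unionE _ pe) (petals_unionE _ pfe).
Qed.

(** Otherwise [Phi] and [Psi] have the same petals. Every interval of [Phi] is then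
    one of [Psi], which by [four_points] determines the cyclic order up to
    reversal, so that conversely intervals of [Psi] are intervals of [Phi]. *)
Lemma strict_split Phi Psi : strict_concatenation Phi Psi ->
  exists a b, same_petal Phi a b /\ ~ same_petal Psi a b.
Proof.
move=> [cPP nPP]; apply: contrapT => h; apply: nPP.
have {}h a b : same_petal Phi a b -> same_petal Psi a b.
  by move=> s; apply: contrapT => n; apply: h; exists a, b.
have hg (i : petal_index Phi) : exists j : petal_index Psi, petal i `<=` petal j.
  have [e pe] := petal_nonempty i; have [j pj] := petal_ex Psi e; exists j => u pu.
  have [|j' [pj' pu']] := h e u; first by exists i.
  by rewrite (petal_inj pj pj').
have [g pg] := choice hg; exists g; split=> // Y iY.
have XE : petals_union (g @^-1` Y) = petals_union Y.
  apply/seteqP; split=> e; have [i pe] := petal_ex Phi e; have pge := pg _ _ pe.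
    by rewrite (petals_unionE _ pe) (petals_unionE _ pge).
  by rewrite (petals_unionE _ pe) (petals_unionE _ pge).
have iX : ival Psi (petals_union (g @^-1` Y)) by rewrite XE; exists Y.
set Z := g @^-1` Y in iX *.
move=> x z Zx Zz xz; apply: contrapT => nZ.
have [u [nZu hu]] : exists u, ~ Z u /\ cyc_rel (index_cyc Phi) x u z.
  apply: contrapT => h'; apply: nZ; left => w hw; apply: contrapT => Zw.
  by apply: h'; exists w.
have [v [nZv hv]] : exists v, ~ Z v /\ cyc_rel (index_cyc Phi) z v x.
  apply: contrapT => h'; apply: nZ; right => w hw; apply: contrapT => Zw.
  by apply: h'; exists w.
have [ex px] := petal_nonempty x; have [ez pz] := petal_nonempty z.
have [eu pu] := petal_nonempty u; have [ev pv] := petal_nonempty v.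
have arc s t : ival Psi (petals_union (between (index_cyc Phi) s t)).
  by apply: (ival_concat cPP); exists (between (index_cyc Phi) s t) => //;
     exact: open_arc_interval.
apply: (@ival_four_points _ _ _ Psi ev ez ex eu _ _ _ (arc u x) (arc z u) (ivalC iX));
  rewrite /= !(petals_unionE _ px) !(petals_unionE _ pz) !(petals_unionE _ pu)
     !(petals_unionE _ pv); split.
- apply: cyc_rot; apply: cyc_trans hu _; do 2! apply: cyc_rot; exact: hv.
- by apply: cyc_rot.
- by move=> hc; case: (cyc_neq hc).
- by move=> hc; case: (cyc_neq hc).
- by apply: cyc_trans hv _; do 2! apply: cyc_rot; exact: hu.
- by do 2! apply: cyc_rot; exact: hu.
- by move=> hc; case: (cyc_neq hc).
- by move=> hc; case: (cyc_neq hc).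
- exact: nZv.
- exact: nZu.
- by apply.
- by apply.
Qed.
End Concat.

(** * Partitions into four arcs *)

Section Quad.
Variables (E : Type) (M : matroid E) (k : nat).
Implicit Types (Phi Psi : pseudoflower M k) (X A B C U S : set E).

(** A partition of the circle into four consecutive arcs. *)
Record quad Psi (Q1 Q2 Q3 Q4 : set E) : Prop := Quad {
  quad12 : Q1 `&` Q2 = set0; quad13 : Q1 `&` Q3 = set0; quad14 : Q1 `&` Q4 = set0;
  quad23 : Q2 `&` Q3 = set0; quad24 : Q2 `&` Q4 = set0; quad34 : Q3 `&` Q4 = set0;
  quadT : Q1 `|` Q2 `|` Q3 `|` Q4 = setT;
  quad_ex1 : exists e, Q1 e; quad_ex2 : exists e, Q2 e;
  quad_ex3 : exists e, Q3 e; quad_ex4 : exists e, Q4 e;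
  quad_ival1 : ival Psi Q1; quad_ival2 : ival Psi Q2;
  quad_ival3 : ival Psi Q3; quad_ival4 : ival Psi Q4;
  quad_ival12 : ival Psi (Q1 `|` Q2); quad_ival23 : ival Psi (Q2 `|` Q3) }.

Lemma quad_rot Psi Q1 Q2 Q3 Q4 : quad Psi Q1 Q2 Q3 Q4 -> quad Psi Q2 Q3 Q4 Q1.
Proof.
move=> q; have [q12 q13 q14 q23 q24 q34 qT _ _ _ _ i1 i2 i3 i4 i12 i23] := q.
split=> //; try by clear -q12 q13 q14 q23 q24 q34 qT; sets.
- exact: quad_ex2 q.
- exact: quad_ex3 q.
- exact: quad_ex4 q.
- exact: quad_ex1 q.
rewrite (_ : Q3 `|` Q4 = ~` (Q1 `|` Q2)); first exact: ivalC.
by clear -q12 q13 q14 q23 q24 q34 qT; sets.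
Qed.

Lemma quad_rev Psi Q1 Q2 Q3 Q4 : quad Psi Q1 Q2 Q3 Q4 -> quad Psi Q1 Q4 Q3 Q2.
Proof.
move=> q; have [q12 q13 q14 q23 q24 q34 qT _ _ _ _ i1 i2 i3 i4 i12 i23] := q.
split=> //; try by clear -q12 q13 q14 q23 q24 q34 qT; sets.
- exact: quad_ex1 q.
- exact: quad_ex4 q.
- exact: quad_ex3 q.
- exact: quad_ex2 q.
- rewrite (_ : Q1 `|` Q4 = ~` (Q2 `|` Q3)); first exact: ivalC.
  by clear -q12 q13 q14 q23 q24 q34 qT; sets.
- rewrite (_ : Q4 `|` Q3 = ~` (Q1 `|` Q2)); first exact: ivalC.
  by clear -q12 q13 q14 q23 q24 q34 qT; sets.
Qed.

Lemma quad_concat Phi Psi Q1 Q2 Q3 Q4 : concatenation Phi Psi ->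
  quad Phi Q1 Q2 Q3 Q4 -> quad Psi Q1 Q2 Q3 Q4.
Proof. by move=> c [*]; split=> //; apply: ival_concat c _. Qed.

Lemma flower_four_petals Phi : flower Phi ->
  exists e1 e2 e3 e4, [/\ ~ same_petal Phi e1 e2, ~ same_petal Phi e1 e3 &
    ~ same_petal Phi e1 e4] /\ [/\ ~ same_petal Phi e2 e3,
    ~ same_petal Phi e2 e4 & ~ same_petal Phi e3 e4].
Proof.
move=> [h4 _]; case: (card_dichotomy [set: petal_index Phi] 4) => [[F _]|[m m4 cT]]; last first.
  by move: h4; rewrite (card_le_eqr cT) card_le_II; lia.
move=> /eq_cardSP[i1 _] /eq_cardSP[i2 [_ n21]] /eq_cardSP[i3 [[_ n31] n32]].
move=> /eq_cardSP[i4 [[[_ n41] n42] n43] _].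
have sep (i j : petal_index Phi) e e' : petal i e -> petal j e' -> ~ [set i] j ->
    ~ same_petal Phi e e'.
  by move=> pi pj ij [l [pl pl']]; apply: ij; rewrite /= (petal_inj pi pl) (petal_inj pj pl').
have [e1 p1] := petal_nonempty i1; have [e2 p2] := petal_nonempty i2.
have [e3 p3] := petal_nonempty i3; have [e4 p4] := petal_nonempty i4.
by exists e1, e2, e3, e4; split; split; eauto 3.
Qed.

(** Otherwise there would be at most three petals. *)
Lemma flower_two_petals Phi A B C : flower Phi -> A `|` B `|` C = setT ->
  [\/ exists a b, [/\ A a, A b & ~ same_petal Phi a b],
      exists a b, [/\ B a, B b & ~ same_petal Phi a b] |
      exists a b, [/\ C a, C b & ~ same_petal Phi a b]].
Proof.
move=> fl ABC; have [e1 [e2 [e3 [e4 [[n12 n13 n14] [n23 n24 n34]]]]]] := flower_four_petals fl.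
have mem e : (A `|` B `|` C) e by rewrite ABC.
have rA a b : A a -> A b -> ~ same_petal Phi a b ->
  exists a b, [/\ A a, A b & ~ same_petal Phi a b] by exists a, b.
have rB a b : B a -> B b -> ~ same_petal Phi a b ->
  exists a b, [/\ B a, B b & ~ same_petal Phi a b] by exists a, b.
have rC a b : C a -> C b -> ~ same_petal Phi a b ->
  exists a b, [/\ C a, C b & ~ same_petal Phi a b] by exists a, b.
by case: (mem e1) => [[?|?]|?]; case: (mem e2) => [[?|?]|?];
  case: (mem e3) => [[?|?]|?]; case: (mem e4) => [[?|?]|?];
  first [ by apply: Or31; eauto 3
        | by apply: Or32; eauto 3
        | by apply: Or33; eauto 3 ].
Qed.

(** The displayed set and its complement are subdivided until there are four
    parts, which is possible as there are four petals. When a distinguishing set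
    is subdivided, [distinguish_part] finds a distinguishing piece. *)
Lemma displayed_quad Phi S P P' : flower Phi -> 0 < k ->
  profile M k P -> profile M k P' ->
  displayed Phi S -> set_distinguishes S P P' ->
  exists Q1 Q2 Q3 Q4, quad Phi Q1 Q2 Q3 Q4 /\
   [\/ set_distinguishes Q1 P P', set_distinguishes Q2 P P',
      set_distinguishes Q3 P P' | set_distinguishes Q4 P P'].
Proof.
move=> fl k0 pP pP' /displayed_ival[iS eS nS] dS.
have [U [V [W [[iU iV iW] [eU eV eW] [UV UW VW] [UVW dW]]]]] :
  exists U V W, [/\ [/\ ival Phi U, ival Phi V & ival Phi W],
    [/\ exists e, U e, exists e, V e & exists e, W e],
    [/\ U `&` V = set0, U `&` W = set0 & V `&` W = set0] &
    U `|` V `|` W = setT /\ set_distinguishes W P P'].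
  have key A : ival Phi A -> (exists e, A e) -> (exists e, ~ A e) ->
    set_distinguishes (~` A) P P' ->
    (exists a b, [/\ A a, A b & ~ same_petal Phi a b]) ->
    exists U V W, [/\ [/\ ival Phi U, ival Phi V & ival Phi W],
      [/\ exists e, U e, exists e, V e & exists e, W e],
      [/\ U `&` V = set0, U `&` W = set0 & V `&` W = set0] &
      U `|` V `|` W = setT /\ set_distinguishes W P P'].
    move=> iA eA nA dA [a [b [Aa Ab ab]]].
    have [||X [iX iX' _ XA hX]] := ival_split iA (ival0 Phi) _ (setI0 _) _ Aa Ab ab.
    - by rewrite set0U.
    - by rewrite set0U.
    rewrite set0U in iX' XA.
    exists X, (A `\` X), (~` A); split.
    - by split=> //; exact: ivalC.
    - by split=> //; case: hX => -[? ?]; [exists a|exists b|exists b|exists a].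
    - by split; clear -XA; sets.
    - by split=> //; clear -XA; sets.
  have iSC := ivalC iS.
  case: (@flower_two_petals Phi S (~` S) (~` S) fl) => [||h|h].
  - by sets.
  - by move=> h; apply: (key S) => //; apply: distinguish_setC.
  - by apply: (key (~` S)) => //; [case: eS => e ?; exists e; apply|rewrite setCK].
  - by apply: (key (~` S)) => //; [case: eS => e ?; exists e; apply|rewrite setCK].
have small X : ival Phi X -> small_sets M k X.
  by move=> /ival_lam_le[m mk lX]; apply: small_lam lX _; lia.
(* The piece of [A] next to [B] is cut off, so that the pieces come in the
   cyclic order [A \ X], [X & A], [B], [C]. *)
have key A B C : [/\ ival Phi A, ival Phi B & ival Phi C] ->
    [/\ exists e, A e, exists e, B e & exists e, C e] ->
    [/\ A `&` B = set0, A `&` C = set0 & B `&` C = set0] ->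
    A `|` B `|` C = setT ->
    [\/ set_distinguishes A P P', set_distinguishes B P P' | set_distinguishes C P P'] ->
    (exists a b, [/\ A a, A b & ~ same_petal Phi a b]) ->
    exists Q1 Q2 Q3 Q4, quad Phi Q1 Q2 Q3 Q4 /\
   [\/ set_distinguishes Q1 P P', set_distinguishes Q2 P P',
      set_distinguishes Q3 P P' | set_distinguishes Q4 P P'].
  move=> [iA iB iC] [eA eB eC] [AB AC BC] ABC dd [a [b [Aa Ab ab]]].
  have [c Cc] := eC.
  have BA : B `|` A = ~` C by clear -AB AC BC ABC; sets.
  have [||X [iX iX' BX XU hX]] := ival_split iA iB _ AB _ Aa Ab ab.
  - by rewrite BA; exact: ivalC.
  - by exists c; rewrite BA; apply.
  have iXA : ival Phi (X `&` A).
    apply: ivalI => //; exists c; clear -XU AC BC BA Cc.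
    by split; sets.
  have iAX : ival Phi (A `\` X).
    by rewrite (_ : A `\` X = (B `|` A) `\` X) //; clear -BX; sets.
  exists (A `\` X), (X `&` A), B, C; split.
    split=> //; try by clear -XU AB AC BC ABC BX; sets.
    - by case: hX => -[? ?]; [exists b|exists a].
    - by case: hX => -[? ?]; [exists a|exists b].
    - by rewrite (_ : _ `|` _ = A) //; sets.
    - by rewrite (_ : _ `|` _ = X) //; clear -XU BX; sets.
  case: dd => dd; [|by apply: Or43|by apply: Or44].
  have e : (A `\` X) `|` (X `&` A) = ~` ~` A by sets.
  case: (distinguish_part pP pP' (small _ iAX) (small _ iXA) e (distinguish_setC dd)) => d.
    by apply: Or41.
  by apply: Or42.
case: (flower_two_petals fl UVW) => h.
- by apply: (key U V W) => //; apply: Or33.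
- apply: (key V U W) => //; [by rewrite setIC|by rewrite (setUC V)|exact: Or33].
- apply: (key W U V) => //; [by rewrite !(setIC W)|by clear -UVW; sets|exact: Or31].
Qed.
End Quad.

(** * The concatenation with four petals *)

Section Four.
Notation o0 := (@Ordinal 4 0 isT).
Notation o1 := (@Ordinal 4 1 isT).
Notation o2 := (@Ordinal 4 2 isT).
Notation o3 := (@Ordinal 4 3 isT).

Lemma ord4_case (i : 'I_4) : [\/ i = o0, i = o1, i = o2 | i = o3].
Proof.
case: i => [[|[|[|[|//]]]]] h; [apply: Or41|apply: Or42|apply: Or43|apply: Or44];
  exact: val_inj.
Qed.

Definition cyc4_rel (x y z : 'I_4) : Prop :=
  [|| x < y < z, y < z < x | z < x < y].

Lemma cyc4_rot x y z : cyc4_rel x y z -> cyc4_rel y z x.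
Proof. by rewrite /cyc4_rel; lia. Qed.

Lemma cyc4_asym x y z : cyc4_rel x y z -> ~ cyc4_rel z y x.
Proof. by rewrite /cyc4_rel; lia. Qed.

Lemma cyc4_trans x y z w : cyc4_rel x y z -> cyc4_rel x z w -> cyc4_rel x y w.
Proof. by rewrite /cyc4_rel; lia. Qed.

Lemma cyc4_total x y z : x <> y -> y <> z -> x <> z ->
  cyc4_rel x y z \/ cyc4_rel z y x.
Proof.
have ne (i j : 'I_4) : i <> j -> (i : nat) != j.
  by move=> h; apply/eqP => e; apply: h; exact: val_inj.
move=> /ne h1 /ne h2 /ne h3; apply/orP; rewrite /cyc4_rel; lia.
Qed.

Definition cyc4 := CyclicOrder cyc4_rot cyc4_asym cyc4_trans cyc4_total.

Lemma cyc4_interval (Y : set 'I_4) : is_interval cyc4 Y ->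
  ~ [/\ Y o0, Y o2, ~ Y o1 & ~ Y o3] /\ ~ [/\ Y o1, Y o3, ~ Y o0 & ~ Y o2].
Proof.
move=> iY; split=> -[h1 h2 h3 h4].
  by case: (iY o0 o2 h1 h2 ltac:(by [])) => h; [apply: h3|apply: h4]; apply: h.
by case: (iY o1 o3 h1 h2 ltac:(by [])) => h; [apply: h4|apply: h3]; apply: h.
Qed.

Variables (E : Type) (M : matroid E) (k : nat) (Phi : pseudoflower M k).
Variables (Q1 Q2 Q3 Q4 : set E).
Hypothesis q : quad Phi Q1 Q2 Q3 Q4.

Definition petal4 (i : 'I_4) := nth set0 [:: Q1; Q2; Q3; Q4] i.

Lemma petal4_union (Y : set 'I_4) : \bigcup_(i in Y) petal4 i =
  [set _ | Y o0] `&` Q1 `|` [set _ | Y o1] `&` Q2 `|`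
  [set _ | Y o2] `&` Q3 `|` [set _ | Y o3] `&` Q4.
Proof.
apply/seteqP; split=> e.
  move=> [i Yi]; case: (ord4_case i) Yi => -> Yi Qe.
  - by left; left; left.
  - by left; left; right.
  - by left; right.
  - by right.
by move=> [[[[Yi Qe]|[Yi Qe]]|[Yi Qe]]|[Yi Qe]]; eexists; eauto.
Qed.

Lemma petal4_ival (Y : set 'I_4) : is_interval cyc4 Y ->
  ival Phi (\bigcup_(i in Y) petal4 i).
Proof.
move=> /cyc4_interval[n02 n13]; rewrite petal4_union.
have [q12 q13 q14 q23 q24 q34 qT _ _ _ _ i1 i2 i3 i4 i12 i23] := q.
have i34 := quad_ival12 (quad_rot (quad_rot q)).
have i41 := quad_ival23 (quad_rot (quad_rot q)).
have eqv X X' : ival Phi X -> X' = X -> ival Phi X' by move=> ? ->.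
case: (EM (Y o0)) => y0; case: (EM (Y o1)) => y1; case: (EM (Y o2)) => y2;
  case: (EM (Y o3)) => y3; try by [case: n02|case: n13].
all: try rewrite (propT y0); try rewrite (propF y0).
all: try rewrite (propT y1); try rewrite (propF y1).
all: try rewrite (propT y2); try rewrite (propF y2).
all: try rewrite (propT y3); try rewrite (propF y3).
all: clear n02 n13 y0 y1 y2 y3.
- by apply: eqv (ivalC (ival0 Phi)) _; clear -qT; sets.
- by apply: eqv (ivalC i4) _; clear -q14 q24 q34 qT; sets.
- by apply: eqv (ivalC i3) _; clear -q13 q23 q34 qT; sets.
- by apply: eqv i12 _; clear; sets.
- by apply: eqv (ivalC i2) _; clear -q12 q23 q24 qT; sets.
- by apply: eqv i41 _; clear; sets.
- by apply: eqv i1 _; clear; sets.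
- by apply: eqv (ivalC i1) _; clear -q12 q13 q14 qT; sets.
- by apply: eqv i23 _; clear; sets.
- by apply: eqv i2 _; clear; sets.
- by apply: eqv i34 _; clear; sets.
- by apply: eqv i3 _; clear; sets.
- by apply: eqv i4 _; clear; sets.
- by apply: eqv (ival0 Phi) _; clear; sets.
Qed.

Lemma petal4_partition : partition setT petal4 setT.
Proof.
have [q12 q13 q14 q23 q24 q34 qT e1 e2 e3 e4 _ _ _ _ _ _] := q; split.
- by rewrite /cover petal4_union -qT; clear; sets.
- have dis (A B : set E) : A `&` B = set0 -> A `&` B !=set0 -> False.
    by move=> -> [].
  by move=> i j _ _; case: (ord4_case i) => ->; case: (ord4_case j) => -> //=;
    try (move=> /dis; case=> //); rewrite ?(setIC Q2) ?(setIC Q3) ?(setIC Q4) // => /dis; case.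
- by move=> i _; case: (ord4_case i) => ->.
Qed.

Lemma petal4_order (Y : set 'I_4) : is_interval cyc4 Y ->
  enat_le (connectivity M (\bigcup_(i in Y) petal4 i)) k.-1.
Proof. by move=> /petal4_ival/ival_lam_le[m mk /connectivityP ->]. Qed.

(** The concatenation of [Phi] with the four parts as petals. *)
Definition flower4 : pseudoflower M k :=
  @Pseudoflower E M k 'I_4 cyc4 petal4 petal4_partition petal4_order.

Lemma flower4_concat : concatenation flower4 Phi.
Proof.
have i4 (j : 'I_4) : ival Phi (petal4 j).
  by have [*] := q; case: (ord4_case j) => ->.
have hf (i : petal_index Phi) : exists j : petal_index flower4, petal i `<=` petal j.
  have [e pe] := petal_nonempty i; have [j pj] := petal_ex flower4 e.
  exists j => e' pe'; apply: ival_same_petal pj; first exact: i4.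
  by exists i.
have [f pf] := choice hf; exists f; split=> // Y iY.
have [Z iZ UZ] := petal4_ival iY.
rewrite (_ : f @^-1` Y = Z) //; apply/seteqP; split=> i;
  have [e pe] := petal_nonempty i; have pfe := pf _ _ pe.
  move=> Yi; apply/(petals_unionP _ pe); rewrite -UZ.
  by exists (f i).
move=> Zi; apply/(petals_unionP _ pfe); rewrite /petals_union /= UZ.
by exists i.
Qed.

(** The union of opposite parts is not an interval of the concatenation with four
    petals, so that its order is not [k.-1] in a daisy; it is not smaller either, by
    submodularity. *)
Lemma daisy_quad : daisy Phi -> ~ lam_le M k.-1 (Q1 `|` Q3).
Proof.
move=> [fl dPhi] [m mk lQ].
have fin : finite_set [set: petal_index flower4] by exact: finite_finset.
pose Y := [set i : petal_index flower4 | i = o0 \/ i = o2].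
have nY : nontrivial Y.
  split=> h.
    by have : Y o0 by [left]; rewrite h.
  have : Y o1 by rewrite h.
  by case.
have /= := dPhi _ flower4_concat fin Y nY.
have -> : petals_union Y = Q1 `|` Q3.
  apply/seteqP; split=> e.
    by move=> [j [->|->]]; [left|right].
  by move=> [Qe|Qe]; [exists o0 => //; left|exists o2 => //; right].
have niY : ~ interval Y.
  move=> /cyc4_interval[h _]; apply: h; split; [by left|by right|by case|by case].
have [q12 q13 q14 q23 q24 q34 qT e1 e2 e3 e4 i1 i2 i3 i4' i12 i23] := q.
have [x1 Qx1] := e1; have [x4 Qx4] := e4.
have l1 : lam M Q1 k.-1 by apply: (ival_lam fl i1) => //; exists x4; clear -q14 Qx4; sets.
have l12 : lam M (Q1 `|` Q2) k.-1.
  by apply: (ival_lam fl i12); [exists x1; left|exists x4; clear -q14 q24 Qx4; sets].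
have l123 : lam M (~` Q4) k.-1.
  by apply: lamC; apply: (ival_lam fl i4') => //; exists x1; clear -q14 Qx1; sets.
have [i [u [li lu le]]] := lam_uncross lQ l12.
rewrite (_ : _ `&` _ = Q1) in li; last by clear -q23; sets.
rewrite (_ : _ `|` _ = ~` Q4) in lu; last by clear -q14 q24 q34 qT; sets.
have := lam_inj li l1; have := lam_inj lu l123 => ? ?.
have mE : m = k.-1 by lia.
by move=> -[h _]; apply: niY; apply: h; apply/connectivityP; rewrite -mE.
Qed.
End Four.

(** * Chains of flowers *)

Lemma dependent_sequence (T : Type) (D : T -> Prop) (R : T -> T -> Prop) :
  (exists x, D x) -> (forall x, D x -> exists2 y, D y & R x y) ->
  exists s : nat -> T, (forall n, D (s n)) /\ (forall n, R (s n) (s n.+1)).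
Proof.
move=> [x0 D0] h.
have h' (x : {x | D x}) : exists y : {x | D x}, R (sval x) (sval y).
  by case: x => x Dx; have [y Dy Rxy] := h x Dx; exists (exist _ y Dy).
have [f hf] := choice h'.
exists (fun n => sval (iter n f (exist _ x0 D0))); split=> n; first exact: svalP.
exact: hf.
Qed.

Section Sequence.
Variables (E : Type) (M : matroid E) (k : nat) (P P' : set (set E)).
Hypotheses (k0 : 0 < k) (pP : profile M k P) (pP' : profile M k P').
Hypothesis tPP : truncation M k.-1 P = truncation M k.-1 P'.
Variable F : nat -> pseudoflower M k.
Hypotheses (fF : forall n, flower (F n))
  (sF : forall n, strict_concatenation (F n) (F n.+1)).
Implicit Types X Y Q : set E.

Lemma ival_mono m n X : m <= n -> ival (F m) X -> ival (F n) X.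
Proof.
move=> /subnK <-; elim: (n - m) => [//|d IH] /IH; rewrite addSn.
by apply: ival_concat; case: (sF (d + m)).
Qed.

Definition all_quad Q1 Q2 Q3 Q4 := forall n, quad (F n) Q1 Q2 Q3 Q4.

Definition some_part_distinguishes Q1 Q2 Q3 Q4 :=
  [\/ set_distinguishes Q1 P P', set_distinguishes Q2 P P',
      set_distinguishes Q3 P P' | set_distinguishes Q4 P P'].

(** The arcs [X i \ Q4] are as [no_arc_limit] requires, from [i = 1] on, where they
    are not empty. *)
Lemma no_increasing_arcs Q1 Q2 Q3 Q4 (X : nat -> set E) :
  all_quad Q1 Q2 Q3 Q4 -> ~ lam_le M k.-1 (Q1 `|` Q3) -> some_part_distinguishes Q1 Q2 Q3 Q4 ->
  (forall i, exists n, ival (F n) (X i)) ->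
  (forall i, Q4 `<=` X i) -> (forall i, X i `<=` Q4 `|` Q1) ->
  (forall i, X i `<` X i.+1) -> False.
Proof.
move=> qF nQ dQ iX QX XQ inc.
have [q12 q13 q14 q23 q24 q34 qT [e1 Qe1] [e2 Qe2] [e3 Qe3] [e4 Qe4] _ _ _ _ _ _] := qF 0.
have Xinc i : X i `<=` X i.+1 by case: (inc i).
have Xlt i j : i < j -> exists e, X j e /\ ~ X i e.
  move=> ij; have [_ h] := inc i.
  have [e [Xe nXe]] : exists e, X i.+1 e /\ ~ X i e.
    apply: contrapT => h'; apply: h => e Xe; apply: contrapT => nXe.
    by apply: h'; exists e.
  by exists e; split=> //; apply: (increasing_subset Xinc ij).
pose x i := X i.+1 `\` Q4.
have xQ i : x i `<=` Q1 by have := XQ i.+1; rewrite /x; sets.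
have xinc i : x i `<=` x i.+1 by have := Xinc i.+1; rewrite /x; sets.
have xex i : exists e, x i e.
  have [e [Xe nXe]] := Xlt i i.+1 (ltnSn _); exists e; split=> // Qe.
  by apply: nXe; apply: QX.
have xnex i : exists e, Q1 e /\ ~ x i e.
  have [e [Xe nXe]] := Xlt i.+1 i.+2 (ltnSn _); exists e.
  case: (XQ _ _ Xe) => [Qe|Qe]; first by case: nXe; apply: QX.
  by split=> // -[].
have xE i : x i = X i.+1 `&` Q1 by have := XQ i.+1; rewrite /x; sets.
have ix i : exists n, ival (F n) (x i).
  have [n iXn] := iX i.+1; exists n; rewrite xE; apply: ivalI => //.
    by case: (qF n).
  by exists e2; have := XQ i.+1; clear -Qe2 q12 q24; split; sets.
have lamF S n : ival (F n) S -> (exists e, S e) -> (exists e, ~ S e) -> lam M S k.-1.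
  by apply: ival_lam.
apply: (@no_arc_limit E M k P P' Q1 Q2 Q3 Q4 x) => //.
- apply: (lamF _ 0); [by case: (qF 0)|by exists e1|exists e2].
  by clear -q12 Qe2; sets.
- move=> i j ij; have [n1 i1] := iX i.+1; have [n2 i2] := ix j.
  have [e [Xe nXe]] := Xlt i.+1 j.+1 ij.
  have nQe : ~ Q4 e by move=> Qe; apply: nXe; apply: QX.
  apply: (lamF _ (n1 + n2)); last first.
  + by exists e2; have := xQ j; clear -q12 Qe2; sets.
  + by exists e; split; [|move=> []].
  rewrite (_ : x j `\` x i = x j `&` ~` (X i.+1)); last first.
    by have := QX i.+1; rewrite /x; sets.
  apply: ivalI; [by apply: ival_mono i2; lia|by apply: ivalC; apply: ival_mono i1; lia|].
  exists e4; split; first by have := xQ j; clear -q14 Qe4; sets.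
  by apply; apply: QX.
- move=> i; have [n i1] := ix i; apply: (lamF _ n) => //.
  by exists e2; have := xQ i; clear -q12 Qe2; sets.
- move=> i; have [n i1] := iX i.+1.
  rewrite (_ : x i `|` Q4 = X i.+1); last by have := QX i.+1; rewrite /x; sets.
  apply: (lamF _ n) => //; first by exists e4; apply: QX.
  by exists e2; have := XQ i.+1; clear -q12 q24 Qe2; sets.
- move=> i; have [n i1] := iX i.+1; have qn := qF n.
  have i34 := quad_ival12 (quad_rot (quad_rot qn)).
  rewrite (_ : x i `|` (Q3 `|` Q4) = X i.+1 `|` (Q3 `|` Q4)); last first.
    by rewrite /x; sets.
  apply: (lamF _ n).
  + by apply: ivalU => //; exists e4; split; [apply: QX|right].
  + by exists e4; right; right.
  + by exists e2; have := XQ i.+1; clear -q12 q24 q23 Qe2; sets.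
- move=> i; have [n i1] := iX i.+1; have qn := qF n.
  have [e [Qe nxe]] := xnex i.
  rewrite (_ : x i `|` (Q2 `|` Q3 `|` Q4) = X i.+1 `|` ~` Q1); last first.
    by rewrite /x; clear -q12 q13 q14 qT; sets.
  apply: (lamF _ n).
  + apply: ivalU => //; first by apply: ivalC; case: qn.
    by exists e4; split; [apply: QX|clear -q14 Qe4; sets].
  + by exists e4; left; apply: QX.
  + exists e => -[Xe|]; last by apply.
    by apply: nxe; split=> //; clear -q14 Qe; sets.
Qed.

(** The end of [X] inside [Q1] is a cut that appears at stage [n.+1]. *)
Definition new_arc Q1 Q4 n X :=
  [/\ ival (F n.+1) X, ~ ival (F n) X, Q4 `<=` X & X `<=` Q4 `|` Q1].

(** Two incomparable arcs would, together with [Q1], separate four points in all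
    three ways. *)
Lemma arcs_comparable Q1 Q2 Q3 Q4 m n X Y : all_quad Q1 Q2 Q3 Q4 ->
  ival (F m) X -> ival (F n) Y -> Q4 `<=` X -> X `<=` Q4 `|` Q1 ->
  Q4 `<=` Y -> Y `<=` Q4 `|` Q1 -> ~ Y `<=` X -> X `<=` Y.
Proof.
move=> qF iX iY QX XQ QY YQ nYX x Xx; apply: contrapT => nYx.
have [y [Yy nXy]] : exists y, Y y /\ ~ X y.
  apply: contrapT => h; apply: nYX => y Yy; apply: contrapT => nXy.
  by apply: h; exists y.
have [q12 q13 q14 q23 q24 q34 qT _ _ [h Qh] [g Qg] i1 _ _ _ _ _] := qF (m + n).
have iX' : ival (F (m + n)) X by apply: ival_mono iX; lia.
have iY' : ival (F (m + n)) Y by apply: ival_mono iY; lia.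
have Q1x : Q1 x by case: (XQ _ Xx) => // Qx; case: nYx; apply: QY.
have Q1y : Q1 y by case: (YQ _ Yy) => // Qy; case: nXy; apply: QX.
have nQ1g : ~ Q1 g by clear -q14 Qg; sets.
have nQ1h : ~ Q1 h by clear -q13 Qh; sets.
have nQ4h : ~ Q4 h by clear -q34 Qh; sets.
have nXh : ~ X h by move=> /XQ[].
have nYh : ~ Y h by move=> /YQ[].
apply: (@ival_four_points _ _ _ (F (m + n)) g x y h _ _ _ iX' iY' (ivalC i1)).
- by split=> //; apply: QX.
- by split=> //; apply: QY.
- by split=> //; apply.
Qed.

(** The complements increase, in the reversed cyclic order of the four parts. *)
Lemma no_decreasing_arcs Q1 Q2 Q3 Q4 (X : nat -> set E) :
  all_quad Q1 Q2 Q3 Q4 -> ~ lam_le M k.-1 (Q1 `|` Q3) -> some_part_distinguishes Q1 Q2 Q3 Q4 ->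
  (forall i, exists n, ival (F n) (X i)) ->
  (forall i, Q4 `<=` X i) -> (forall i, X i `<=` Q4 `|` Q1) ->
  (forall i, X i.+1 `<` X i) -> False.
Proof.
move=> qF nQ dQ iX QX XQ dec.
have [q12 q13 q14 q23 q24 q34 qT _ _ _ [e4 Qe4] _ _ _ _ _ _] := qF 0.
apply: (@no_increasing_arcs Q1 Q4 Q3 Q2 (fun i => ~` X i `&` (Q1 `|` Q2))) => //.
- by move=> n; apply: quad_rev.
- by case: dQ; [apply: Or41|apply: Or44|apply: Or43|apply: Or42].
- move=> i; have [n i1] := iX i; exists n; apply: ivalI; first exact: ivalC.
    by case: (qF n).
  by exists e4; split; [apply; apply: QX|clear -q14 q24 Qe4; sets].
- by move=> i; have := XQ i; clear -q12 q24; sets.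
- by move=> i; clear; sets.
- move=> i; have [s ns] := dec i; split; first by clear -s; sets.
  move=> h; apply: ns; have := XQ i; have := QX i.+1; clear -h; sets.
Qed.

(** New arcs at different stages are distinct and comparable, so that infinitely
    many of them would contain a strictly monotone sequence: a decreasing one if
    infinitely many arcs contain all later ones, and an increasing one otherwise. *)
Lemma finitely_many_new_arcs Q1 Q2 Q3 Q4 :
  all_quad Q1 Q2 Q3 Q4 -> ~ lam_le M k.-1 (Q1 `|` Q3) -> some_part_distinguishes Q1 Q2 Q3 Q4 ->
  exists N, forall n X, N <= n -> ~ new_arc Q1 Q4 n X.
Proof.
move=> qF nQ dQ; apply: contrapT => inf.
have {}inf N : exists n X, N <= n /\ new_arc Q1 Q4 n X.
  apply: contrapT => h; apply: inf; exists N => n X Nn hX.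
  by apply: h; exists n, X.
have neq m n X Y : m < n -> new_arc Q1 Q4 m X -> new_arc Q1 Q4 n Y -> X <> Y.
  by move=> mn [iX _ _ _] [_ nY _ _] e; apply: nY; rewrite -e; apply: ival_mono iX.
pose peak (p : nat * set E) := new_arc Q1 Q4 p.1 p.2 /\
  forall n Y, p.1 < n -> new_arc Q1 Q4 n Y -> Y `<=` p.2.
case: (EM (forall N, exists2 p, peak p & N <= p.1)) => [peaks|nopeaks].
  pose R (p p' : nat * set E) := p.1 < p'.1.
  have [||s [Ds Rs]] := @dependent_sequence _ peak R.
  - by have [p hp _] := peaks 0; exists p.
  - by move=> p _; have [p' hp' pp'] := peaks p.1.+1; exists p'.
  apply: (@no_decreasing_arcs Q1 Q2 Q3 Q4 (fun i => (s i).2)) => // i;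
    have [[iX nX QX XQ] pk] := Ds i => //.
    by exists (s i).1.+1.
  have [hX' _] := Ds i.+1.
  split; first by apply: pk hX'; apply: Rs.
  move=> sub; apply: (neq _ _ _ _ (Rs i) (proj1 (Ds i)) hX').
  by apply/seteqP; split=> //; apply: pk hX'; apply: Rs.
have [N hN] : exists N, forall p, N <= p.1 -> ~ peak p.
  apply: contrapT => h; apply: nopeaks => N; apply: contrapT => h'; apply: h.
  by exists N => p Np pk; apply: h'; exists p.
pose D (p : nat * set E) := N <= p.1 /\ new_arc Q1 Q4 p.1 p.2.
pose R (p p' : nat * set E) := p.2 `<` p'.2.
have [||s [Ds Rs]] := @dependent_sequence _ D R.
- by have [n [X [Nn hX]]] := inf N; exists (n, X).
- move=> [m X] [/= Nm hX].
  have [n [Y [mn hY nYX]]] : exists n Y, [/\ m < n, new_arc Q1 Q4 n Y & ~ Y `<=` X].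
    apply: contrapT => h; apply: (hN (m, X) Nm); split=> //= n Y mn hY.
    by apply: contrapT => nYX; apply: h; exists n, Y.
  exists (n, Y); first by split=> //=; lia.
  split=> //=; have [iX _ QX XQ] := hX; have [iY _ QY YQ] := hY.
  exact: (arcs_comparable qF iX iY).
apply: (@no_increasing_arcs Q1 Q2 Q3 Q4 (fun i => (s i).2)) => // i;
  have [_ [iX _ QX XQ]] := Ds i => //.
by exists (s i).1.+1.
Qed.

(** Refining a petal creates a cut inside the part that contains this petal. *)
Lemma some_new_arc Q1 Q2 Q3 Q4 n : all_quad Q1 Q2 Q3 Q4 ->
  exists X, [\/ new_arc Q1 Q4 n X, new_arc Q2 Q1 n X, new_arc Q3 Q2 n X |
    new_arc Q4 Q3 n X].
Proof.
move=> qF; have [a [b [sab nab]]] := strict_split (sF n).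
have key Q1' Q2' Q3' Q4' : all_quad Q1' Q2' Q3' Q4' -> Q1' a ->
    exists X, new_arc Q1' Q4' n X.
  move=> qF' Qa; have qn := qF' n.
  have Qb : Q1' b by apply: ival_same_petal sab Qa; case: qn.
  have qn1 := qF' n.+1; have q41 := quad_ival12 (quad_rot (quad_rot (quad_rot qn1))).
  have [q12 q13 q14 q23 q24 q34 qT _ _ [e3 Qe3] _ i1 _ _ i4 _ _] := qn1.
  have [|X [iX _ QX XQ hX]] := ival_split i1 i4 q41 q14 _ Qa Qb nab.
    by exists e3; clear -q13 q34 Qe3; sets.
  exists X; split=> // iXn.
  have sba : same_petal (F n) b a by case: sab => i [? ?]; exists i.
  by case: hX => -[Xa nXb]; apply: nXb; [exact: (ival_same_petal iXn sab)|exact: (ival_same_petal iXn sba)].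
have qF2 m := quad_rot (qF m); have qF3 m := quad_rot (qF2 m).
have qF4 m := quad_rot (qF3 m).
have : [set: E] a by []; rewrite -(quadT (qF 0)) => -[[[Qa|Qa]|Qa]|Qa].
- by have [X hX] := key _ _ _ _ qF Qa; exists X; apply: Or41.
- by have [X hX] := key _ _ _ _ qF2 Qa; exists X; apply: Or42.
- by have [X hX] := key _ _ _ _ qF3 Qa; exists X; apply: Or43.
- by have [X hX] := key _ _ _ _ qF4 Qa; exists X; apply: Or44.
Qed.

Lemma no_infinite_chain Q1 Q2 Q3 Q4 : all_quad Q1 Q2 Q3 Q4 ->
  ~ lam_le M k.-1 (Q1 `|` Q3) -> some_part_distinguishes Q1 Q2 Q3 Q4 -> False.
Proof.
move=> qF nQ dQ.
have qF2 m := quad_rot (qF m); have qF3 m := quad_rot (qF2 m).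
have qF4 m := quad_rot (qF3 m).
have [q12 q13 q14 q23 q24 q34 qT _ _ _ _ _ _ _ _ _ _] := qF 0.
have nQ' : ~ lam_le M k.-1 (Q2 `|` Q4).
  move=> /lam_leC; rewrite (_ : ~` _ = Q1 `|` Q3) //.
  by clear -q12 q13 q14 q23 q24 q34 qT; sets.
have [N1 h1] := finitely_many_new_arcs qF nQ dQ.
have [|N2 h2] := finitely_many_new_arcs qF2 nQ'.
  by case: dQ; [apply: Or44|apply: Or41|apply: Or42|apply: Or43].
have [||N3 h3] := finitely_many_new_arcs qF3.
- by rewrite setUC.
- by case: dQ; [apply: Or43|apply: Or44|apply: Or41|apply: Or42].
have [||N4 h4] := finitely_many_new_arcs qF4.
- by rewrite setUC.
- by case: dQ; [apply: Or42|apply: Or43|apply: Or44|apply: Or41].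
have [X] := some_new_arc (N1 + N2 + N3 + N4) qF.
by case; [apply: h1|apply: h2|apply: h3|apply: h4]; lia.
Qed.
End Sequence.

Theorem corollary11p9 (E : Type) (M : matroid E) (k : nat)
    (Phi : pseudoflower M k) :
  1 <= k ->
  daisy Phi ->
  (exists P P' : set (set E),
    [/\ profile M k P, profile M k P',
        truncation M k.-1 P = truncation M k.-1 P'
      & distinguishes Phi P P']) ->
  ~ exists F : nat -> pseudoflower M k,
      (forall n, flower (F n) /\ concatenation Phi (F n)) /\
      (forall n, strict_concatenation (F n) (F n.+1)).
Proof.
move=> k0 dPhi [P [P' [pP pP' tPP [S dS SPP]]]] [F [hF sF]].
have [Q1 [Q2 [Q3 [Q4 [q dQ]]]]] := displayed_quad (proj1 dPhi) k0 pP pP' dS SPP.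
apply: (@no_infinite_chain E M k P P' k0 pP pP' tPP F _ sF Q1 Q2 Q3 Q4) => //.
- by move=> n; case: (hF n).
- by move=> n; apply: quad_concat q; case: (hF n).
- exact: daisy_quad q dPhi.
Qed.
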